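(* Let $(r,u,v)$ denote coordinates on $\mathbb{R}^3$. Given any smooth real function $R=R(u,v)$ of the two variables $u$ and $v$, there exists a Sasakian structure on $\mathbb{R}^3$ such that $R$ is the scalar curvature of the associated Riemannian metric.
   Context: Let $\nabla$ be the Levi-Civita connection and $R(X,Y)Z=\nabla_X\nabla_YZ-\nabla_Y\nabla_XZ-\nabla_{[X,Y]}Z$. A Riemannian manifold $(M,g)$ is Sasakian if there exists a unit length Killing vector field $e_0$ on $M$ such that $R(X,e_0)Y=g(e_0,Y)X-g(X,Y)e_0$ for all vector fields $X,Y$ on $M$; the Sasakian structure is the pair $(g,e_0)$. The scalar curvature is normalized so that the unit round 3-sphere has scalar curvature $6$. *)

(* Defs.v *)
From HB Require Import structures.
From mathcomp Require Import all_boot all_order all_algebra.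
From mathcomp Require Import boolp classical_sets functions reals topology.
From mathcomp Require Import normedtype derive ring.

Set Implicit Arguments.
Unset Strict Implicit.
Unset Printing Implicit Defensive.

Import Order.TTheory GRing.Theory Num.Theory.
Import numFieldNormedType.Exports.

Local Open Scope classical_set_scope.
Local Open Scope ring_scope.

(* Riemannian geometry of R^n, n > 0, in the standard global coordinates
   x_0, ..., x_(n-1); R^n is the space 'rV[R]_n of row vectors, written with
   n.+1 in place of n.  A vector field X is identified with its component
   functions, X = \sum_i X_i d/dx_i, where X_i p = X p 0 i.  Both vector fields
   and metrics are plain functions; their smoothness is a separate hypothesis. *)

Definition scalar_fun (R : realType) (n : nat) := 'rV[R]_n.+1 -> R.
Definition vfield (R : realType) (n : nat) := 'rV[R]_n.+1 -> 'rV[R]_n.+1.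
Definition tensor2 (R : realType) (n : nat) := 'rV[R]_n.+1 -> 'M[R]_n.+1.

Section Calculus.
Context {R : realType} {n : nat}.
Implicit Types (f : scalar_fun R n) (X Y : vfield R n) (p : 'rV[R]_n.+1).

Definition pderiv (i : 'I_n.+1) f : scalar_fun R n :=
  fun p => derive f p (delta_mx 0 i).

(* Since s ranges over all finite sequences of indices, the existence
   requirement covers every derivative that occurs in an iterated one. *)
Definition smooth f : Prop :=
  forall s : seq 'I_n.+1, let h := foldr pderiv f s in
    continuous h /\ forall i p, derivable h p (delta_mx 0 i).

Definition smooth_vfield X : Prop := forall i, smooth (fun p => X p 0 i).

(* X acting on functions as a derivation *)
Definition vderiv X f : scalar_fun R n :=
  fun p => \sum_i X p 0 i * pderiv i f p.

Definition bracket X Y : vfield R n := fun p =>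
  \row_k (vderiv X (fun q => Y q 0 k) p - vderiv Y (fun q => X q 0 k) p).

Definition coord_field (i : 'I_n.+1) : vfield R n := fun=> delta_mx 0 i.

End Calculus.

Section Metric.
Context {R : realType} {n : nat}.
Implicit Types (g : tensor2 R n) (X Y Z : vfield R n) (p : 'rV[R]_n.+1).

Definition inner g X Y : scalar_fun R n :=
  fun p => \sum_i \sum_j g p i j * X p 0 i * Y p 0 j.

Record riemannian_metric g : Prop := RiemannianMetric {
  metric_smooth : forall i j, smooth (fun p => g p i j);
  metric_sym : forall p, (g p)^T = g p;
  metric_pos : forall p (v : 'rV[R]_n.+1), v != 0 ->
    0 < \sum_i \sum_j g p i j * v 0 i * v 0 j
}.

(* christoffel g k i j is the symbol with upper index k *)
Definition christoffel g (k i j : 'I_n.+1) : scalar_fun R n := fun p =>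
  2^-1 * \sum_l invmx (g p) k l *
    (pderiv i (fun q => g q j l) p + pderiv j (fun q => g q i l) p
     - pderiv l (fun q => g q i j) p).

(* levi_civita g X Y is nabla_X Y; by levi_civita_torsion_free,
   levi_civita_compat and levi_civita_unique below it is the unique torsion-free
   connection preserving g. *)
Definition levi_civita g X Y : vfield R n := fun p =>
  \row_k (vderiv X (fun q => Y q 0 k) p
          + \sum_i \sum_j christoffel g k i j p * X p 0 i * Y p 0 j).

Definition curvature g X Y Z : vfield R n := fun p =>
  let nabla := levi_civita g in
  nabla X (nabla Y Z) p - nabla Y (nabla X Z) p - nabla (bracket X Y) Z p.

(* Ric(Y, Z) is the trace of X |-> R(X, Y)Z. *)
Definition ricci g Y Z : scalar_fun R n := fun p =>
  \sum_i curvature g (coord_field i) Y Z p 0 i.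

(* The full trace of Ric: with the sign of curvature above, the unit round
   n-sphere has scalar curvature n(n-1), hence 6 for n = 3. *)
Definition scalar_curvature g : scalar_fun R n := fun p =>
  \sum_j \sum_k invmx (g p) j k * ricci g (coord_field j) (coord_field k) p.

(* L_X g = 0 *)
Definition killing g X : Prop :=
  forall Y Z, smooth_vfield Y -> smooth_vfield Z -> forall p,
    vderiv X (inner g Y Z) p
    = inner g (bracket X Y) Z p + inner g Y (bracket X Z) p.

Record sasakian_structure g (e0 : vfield R n) : Prop := SasakianStructure {
  sasakian_metric : riemannian_metric g;
  sasakian_smooth : smooth_vfield e0;
  sasakian_unit : forall p, inner g e0 e0 p = 1;
  sasakian_killing : killing g e0;
  sasakian_curvature : forall X Y, smooth_vfield X -> smooth_vfield Y ->
    forall p, curvature g X e0 Y p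
              = inner g e0 Y p *: X p - inner g X Y p *: e0 p
}.

End Metric.

Section LeviCivita.
Context {R : realType} {n : nat}.
Implicit Types (g : tensor2 R n) (X Y Z : vfield R n) (p : 'rV[R]_n.+1).

Lemma metric_symE g : riemannian_metric g -> forall p i j, g p i j = g p j i.
Proof. by move=> [_ gT _] p i j; rewrite -{1}(gT p) mxE. Qed.

Lemma metric_unit g : riemannian_metric g -> forall p, g p \in unitmx.
Proof.
move=> [_ _ gpos] p; rewrite -row_free_unit -kermx_eq0; apply/rowV0P => v.
move=> /sub_kermxP vg0; apply/eqP/negPn/negP => /(gpos p).
suff -> : \sum_i \sum_j g p i j * v 0 i * v 0 j = (v *m g p *m v^T) 0 0.
  by rewrite vg0 mul0mx mxE ltxx.
rewrite mxE exchange_big; apply: eq_bigr => j _; rewrite !mxE big_distrl /=.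
by apply: eq_bigr => i _; rewrite (mulrC (g p i j)).
Qed.

Lemma christoffelC g : riemannian_metric g ->
  forall k i j p, christoffel g k i j p = christoffel g k j i p.
Proof.
move=> gm k i j p; congr (_ * _); apply: eq_bigr => l _; congr (_ * _).
rewrite (addrC (pderiv i _ p)); congr (_ - pderiv _ _ _).
by apply/funext => q; exact: metric_symE.
Qed.

Lemma levi_civita_torsion_free g X Y : riemannian_metric g ->
  forall p, levi_civita g X Y p - levi_civita g Y X p = bracket X Y p.
Proof.
move=> gm p; apply/rowP => k; rewrite !mxE opprD addrACA.
rewrite [X in _ + (_ - X)]exchange_big -[RHS]addr0; congr (_ + _).
apply/eqP; rewrite subr_eq0; apply/eqP.
apply: eq_bigr => i _; apply: eq_bigr => j _.
by rewrite (christoffelC gm) mulrAC.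
Qed.

Lemma lower_christoffel g : riemannian_metric g -> forall p m i j,
  \sum_k g p m k * christoffel g k i j p =
  2^-1 * (pderiv i (fun q => g q j m) p + pderiv j (fun q => g q i m) p
     - pderiv m (fun q => g q i j) p).
Proof.
move=> gm p m i j; pose w := \col_l
  (pderiv i (fun q => g q j l) p + pderiv j (fun q => g q i l) p
     - pderiv l (fun q => g q i j) p).
transitivity (2^-1 * (g p *m (invmx (g p) *m w)) m 0); last first.
  by rewrite mulKVmx ?metric_unit// mxE.
rewrite mxE big_distrr /=; apply: eq_bigr => k _.
rewrite mulrCA; congr (_ * (_ * _)); rewrite mxE.
by apply: eq_bigr => l _; rewrite mxE.
Qed.

Lemma pderiv_metric g : riemannian_metric g -> forall p k i j,
  pderiv k (fun q => g q i j) p =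
  \sum_l g p l j * christoffel g l k i p + \sum_l g p i l * christoffel g l k j p.
Proof.
move=> gm p k i j; rewrite lower_christoffel//.
under eq_bigr do rewrite (metric_symE gm).
rewrite lower_christoffel// -mulrDr.
have gE a b : (fun q => g q a b) = (fun q => g q b a).
  by apply/funext => q; exact: metric_symE.
rewrite (gE j i) (gE k j) (gE k i).
set a := pderiv k _ p; set b := pderiv i _ p; set c := pderiv j _ p.
by field.
Qed.

Lemma smooth_coord_field (i : 'I_n.+1) :
  smooth_vfield (@coord_field R n i).
Proof.
move=> j s /=.
have [c ->] : exists c : R, foldr pderiv (fun p => coord_field i p 0 j) s = cst c.
  elim: s => [|k s [c IH]] /=; first by exists ((delta_mx 0 i : 'rV[R]_n.+1) 0 j).
  exists 0; rewrite IH; apply/funext => p; exact: derive_cst.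
split=> [p|k p]; [exact: cst_continuous|exact: derivable_cst].
Qed.

Lemma smooth_derivable (f : scalar_fun R n) : smooth f -> forall i p,
  derivable f p (delta_mx 0 i).
Proof. by move=> /(_ [::])[]. Qed.

Lemma pderiv_inner g Y Z k p : riemannian_metric g ->
  smooth_vfield Y -> smooth_vfield Z ->
  pderiv k (inner g Y Z) p = \sum_i \sum_j
    (pderiv k (fun q => g q i j) p * Y p 0 i * Z p 0 j
     + g p i j * pderiv k (fun q => Y q 0 i) p * Z p 0 j
     + g p i j * Y p 0 i * pderiv k (fun q => Z q 0 j) p).
Proof.
move=> [gs _ _] Ys Zs.
have dg i j := @smooth_derivable _ (gs i j) k p.
have dY i := @smooth_derivable _ (Ys i) k p.
have dZ i := @smooth_derivable _ (Zs i) k p.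
have dgY i j : derivable (fun q => g q i j * Y q 0 i) p (delta_mx 0 k).
  exact: derivableM.
have dgYZ i j : derivable (fun q => g q i j * Y q 0 i * Z q 0 j) p (delta_mx 0 k).
  exact: derivableM.
have -> : inner g Y Z = \sum_i \sum_j (fun q => g q i j * Y q 0 i * Z q 0 j).
  apply/funext => q; rewrite fct_sumE; apply: eq_bigr => i _.
  by rewrite fct_sumE.
rewrite /pderiv derive_sum; last by move=> i; exact: derivable_sum.
apply: eq_bigr => i _; rewrite derive_sum//; apply: eq_bigr => j _.
rewrite (deriveM (dgY i j) (dZ j)) (deriveM (dg i j) (dY i)).
by rewrite /GRing.scale /=; ring.
Qed.

Lemma levi_civita_compat g X Y Z : riemannian_metric g ->
  smooth_vfield Y -> smooth_vfield Z -> forall p,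
  vderiv X (inner g Y Z) p =
  inner g (levi_civita g X Y) Z p + inner g Y (levi_civita g X Z) p.
Proof.
move=> gm Ys Zs p; 
pose S1 := \sum_k X p 0 k * \sum_i \sum_j
  (\sum_l g p l j * christoffel g l k i p) * Y p 0 i * Z p 0 j.
pose S2 := \sum_k X p 0 k * \sum_i \sum_j
  (\sum_l g p i l * christoffel g l k j p) * Y p 0 i * Z p 0 j.
pose S3 := \sum_k X p 0 k * \sum_i \sum_j
  g p i j * pderiv k (fun q => Y q 0 i) p * Z p 0 j.
pose S4 := \sum_k X p 0 k * \sum_i \sum_j
  g p i j * Y p 0 i * pderiv k (fun q => Z q 0 j) p.
transitivity (S1 + S2 + S3 + S4).
  rewrite -!big_split; apply: eq_bigr => k _ /=; rewrite pderiv_inner//.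
  rewrite -!mulrDr; congr (_ * _); rewrite -!big_split; apply: eq_bigr => i _ /=.
  rewrite -!big_split; apply: eq_bigr => j _ /=.
  by rewrite pderiv_metric// !mulrDl.
have -> : inner g (levi_civita g X Y) Z p = S3 + S1.
  transitivity (\sum_i \sum_j g p i j * vderiv X (fun q => Y q 0 i) p * Z p 0 j
    + \sum_l \sum_j g p l j *
      (\sum_k \sum_i christoffel g l k i p * X p 0 k * Y p 0 i) * Z p 0 j).
    rewrite -big_split; apply: eq_bigr => i _; rewrite -big_split.
    by apply: eq_bigr => j _; rewrite !mxE mulrDr mulrDl.
  congr (_ + _); last first.
    transitivity (\sum_l \sum_k \sum_j \sum_i
      g p l j * (christoffel g l k i p * X p 0 k * Y p 0 i) * Z p 0 j).
      apply: eq_bigr => l _; rewrite [RHS]exchange_big; apply: eq_bigr => j _ /=.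
      rewrite mulr_sumr mulr_suml; apply: eq_bigr => k _ /=.
      by rewrite mulr_sumr mulr_suml.
    rewrite exchange_big; apply: eq_bigr => k _ /=.
    rewrite exchange_big.
    under eq_bigr do rewrite exchange_big.
    rewrite exchange_big mulr_sumr; apply: eq_bigr => i _ /=.
    rewrite mulr_sumr; apply: eq_bigr => j _ /=.
    rewrite !mulr_suml mulr_sumr; apply: eq_bigr => l _ /=.
    by ring.
  rewrite /S3; under [RHS]eq_bigr do rewrite mulr_sumr.
  rewrite [RHS]exchange_big; apply: eq_bigr => i _ /=.
  under [RHS]eq_bigr do rewrite mulr_sumr.
  rewrite [RHS]exchange_big; apply: eq_bigr => j _ /=.
  by rewrite mulr_sumr mulr_suml; apply: eq_bigr => k _ /=; ring.
have -> : inner g Y (levi_civita g X Z) p = S4 + S2.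
  transitivity (\sum_i \sum_j g p i j * Y p 0 i * vderiv X (fun q => Z q 0 j) p
    + \sum_i \sum_l g p i l * Y p 0 i *
      (\sum_k \sum_j christoffel g l k j p * X p 0 k * Z p 0 j)).
    rewrite -big_split; apply: eq_bigr => i _; rewrite -big_split.
    by apply: eq_bigr => j _; rewrite !mxE mulrDr.
  congr (_ + _); last first.
    rewrite /S2; under [RHS]eq_bigr do rewrite mulr_sumr.
    rewrite [RHS]exchange_big; apply: eq_bigr => i _ /=.
    under eq_bigr do rewrite mulr_sumr.
    rewrite exchange_big; apply: eq_bigr => k _ /=.
    under eq_bigr do rewrite mulr_sumr.
    rewrite exchange_big mulr_sumr; apply: eq_bigr => j _ /=.
    rewrite !mulr_suml mulr_sumr; apply: eq_bigr => l _ /=.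
    by ring.
  rewrite /S4; under [RHS]eq_bigr do rewrite mulr_sumr.
  rewrite [RHS]exchange_big; apply: eq_bigr => i _ /=.
  under [RHS]eq_bigr do rewrite mulr_sumr.
  rewrite [RHS]exchange_big; apply: eq_bigr => j _ /=.
  by rewrite mulr_sumr; apply: eq_bigr => k _ /=; ring.
by ring.
Qed.

Lemma levi_civita_unique g (D : vfield R n -> vfield R n -> vfield R n) :
  riemannian_metric g ->
  (forall X Y, smooth_vfield X -> smooth_vfield Y ->
    forall p, D X Y p - D Y X p = bracket X Y p) ->
  (forall X Y Z, smooth_vfield X -> smooth_vfield Y -> smooth_vfield Z ->
    forall p, vderiv X (inner g Y Z) p
              = inner g (D X Y) Z p + inner g Y (D X Z) p) ->
  forall X Y, smooth_vfield X -> smooth_vfield Y ->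
    forall p, D X Y p = levi_civita g X Y p.
Proof.
move=> gm Dt Dm X Y Xs Ys p.
pose T A B : vfield R n := fun q => D A B q - levi_civita g A B q.
have Tsym A B : smooth_vfield A -> smooth_vfield B -> T A B p = T B A p.
  move=> As Bs; rewrite /T -[D A B p](subrK (D B A p)) Dt//.
  rewrite -(levi_civita_torsion_free _ _ gm) addrAC (addrAC (levi_civita _ _ _ _)).
  by rewrite subrr add0r addrC.
have innerB A B C : inner g (fun q => A q - B q) C p = inner g A C p - inner g B C p.
  rewrite -sumrB; apply: eq_bigr => i _; rewrite -sumrB; apply: eq_bigr => j _.
  by rewrite !mxE; ring.
have innerC A B : inner g A B p = inner g B A p.
  rewrite /inner exchange_big; apply: eq_bigr => i _; apply: eq_bigr => j _.
  by rewrite (metric_symE gm) mulrAC.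
have Tskew A B C : smooth_vfield A -> smooth_vfield B -> smooth_vfield C ->
    inner g (T A B) C p = - inner g (T A C) B p.
  move=> As Bs Cs; rewrite !innerB; have := Dm A B C As Bs Cs p.
  rewrite levi_civita_compat// (innerC B (levi_civita _ _ _)) (innerC B (D _ _)).
  by move=> e; apply/eqP; rewrite -subr_eq0 opprK addrACA -e; apply/eqP; ring.
have T0 C : smooth_vfield C -> inner g (T X Y) C p = 0.
  move=> Cs.
  have swap A B E : smooth_vfield A -> smooth_vfield B ->
      inner g (T A B) E p = inner g (T B A) E p.
    by move=> As Bs; rewrite /inner Tsym.
  suff e : inner g (T X Y) C p = - inner g (T X Y) C p.
    by apply/eqP; rewrite -[_ == 0](mulrn_eq0 _ 2) mulr2n {2}e subrr.
  rewrite {1}Tskew// swap// Tskew// opprK swap// Tskew//.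
  by congr (- _); rewrite swap.
apply/eqP; rewrite -subr_eq0; apply/eqP; rewrite -/(T X Y p).
rewrite -[LHS](mulmxK (metric_unit gm p)).
suff -> : T X Y p *m g p = 0 by rewrite mul0mx.
apply/rowP => j; rewrite [LHS]mxE [RHS]mxE -[RHS](T0 _ (@smooth_coord_field j)).
apply: eq_bigr => i _; rewrite (bigD1 j)//= big1 => [|k kj].
  by rewrite addr0 [coord_field _ _ _ _]mxE !eqxx mulr1 mulrC.
by rewrite [coord_field _ _ _ _]mxE (negPf kj) andbF mulr0.
Qed.

End LeviCivita.

(* Main.v *)
(* Take a surface R^2 with metric e1^2 + e2^2 and Gauss curvature K = 1 + f/2, and
   on R x R^2 put e0 = dr + alpha with d alpha = 2 e1 /\ e2.  Then
   e0^2 + e1^2 + e2^2 is Sasakian with Reeb field d/dr, and by Cartan's structure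
   equations the sectional curvatures of its frame planes are 1, 1 and K - 3,
   so the scalar curvature is 2 K - 2 = f.

   To get such a surface for an arbitrary K, look for e1 = lam du + bet dv and
   e2 = gam dv with e1 closed, i.e., metrics whose u-curves are geodesics that
   need not have unit speed.  With rho = gam_u / lam the curvature equation reads
   gam_u = lam rho, rho_u = - K lam gam, an ordinary differential equation in
   which the speed lam is free.  Prescribing mu = lam rho instead of lam makes it
   explicitly integrable: gam_u = mu and (rho^2)_u = - 2 K mu gam.  If mu is small
   with respect to K and decays in u, then gam and rho^2 stay positive on R^2. *)
From HB Require Import structures.
Require Import Defs.
From mathcomp Require Import all_boot all_order all_algebra.
From mathcomp Require Import boolp classical_sets functions reals ereal topology.
From mathcomp Require Import normedtype derive realfun trigo measure.
From mathcomp Require Import lebesgue_measure lebesgue_integral ftc ring lra.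

Set Implicit Arguments.
Unset Strict Implicit.
Unset Printing Implicit Defensive.

Import Order.TTheory GRing.Theory Num.Theory.
Import numFieldNormedType.Exports.

Local Open Scope classical_set_scope.
Local Open Scope ring_scope.

(** * Closure properties of smooth functions *)

Section SmoothFunctions.
Context {R : realType} {n : nat}.
Implicit Types (f h : scalar_fun R n) (p v : 'rV[R]_n.+1).

Lemma smooth_pderiv f i : smooth f -> smooth (pderiv i f).
Proof. by move=> fs s; have := fs (rcons s i); rewrite foldr_rcons. Qed.

Definition regular f :=
  continuous f /\ forall i p, derivable f p (delta_mx 0 i).

Lemma smooth_regular f : smooth f -> regular f.
Proof. exact: (fun fs => fs [::]). Qed.

(** The recursion applies the innermost derivative first, whereas the sequences in [smooth] list the
    outermost first. In this form each closure property is an induction on the order, driven by one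
    differentiation rule. *)
Fixpoint Cn (m : nat) f : Prop :=
  regular f /\ if m is m'.+1 then forall i, Cn m' (pderiv i f) else True.

Lemma Cn_regular m f : Cn m f -> regular f.
Proof. by case: m => [|m] []. Qed.

Lemma Cn_pderiv m f i : Cn m.+1 f -> Cn m (pderiv i f).
Proof. by move=> [_ fp]; exact (fp i). Qed.

Lemma smoothP f : smooth f <-> forall m, Cn m f.
Proof.
split=> [fs m|fC s].
  elim: m f fs => [|m IH] f fs; split; try exact (smooth_regular fs).
    by [].
  by move=> i; exact (IH _ (smooth_pderiv i fs)).
elim/last_ind: s f fC => [|s i IH] f fC; first exact (Cn_regular (fC 0%N)).
by rewrite foldr_rcons; apply: IH => m; exact (Cn_pderiv i (fC m.+1)).
Qed.

Lemma CnS m f : Cn m.+1 f -> Cn m f.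
Proof.
elim: m f => [|m IH] f [fr fp]; split; try exact fr; first by [].
by move=> i; exact (IH _ (fp i)).
Qed.

Lemma pderiv_cst (c : R) i : pderiv i (cst c : scalar_fun R n) = cst 0.
Proof. by apply/funext => p; exact (derive_cst c p _). Qed.

Lemma Cn_cst m (c : R) : Cn m (cst c).
Proof.
have r (a : R) : regular (cst a).
  by split=> [p|i p]; [exact: cst_continuous|exact: derivable_cst].
elim: m c => [|m IH] c; split; try exact (r c); first by [].
by move=> i; rewrite pderiv_cst; exact (IH 0).
Qed.

Lemma regularD f h : regular f -> regular h -> regular (fun p => f p + h p).
Proof.
move=> [fc fd] [hc hd]; split=> [p|i p]; first exact (cvgD (fc p) (hc p)).
exact (derivableD (fd i p) (hd i p)).
Qed.

Lemma regularM f h : regular f -> regular h -> regular (fun p => f p * h p).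
Proof.
move=> [fc fd] [hc hd]; split=> [p|i p]; first exact (cvgM (fc p) (hc p)).
exact (derivableM (fd i p) (hd i p)).
Qed.

Lemma regularV f : (forall p, f p != 0) -> regular f ->
  regular (fun p => (f p)^-1).
Proof.
move=> f0 [fc fd]; split=> [p|i p]; first exact (cvgV (f0 p) (fc p)).
exact (derivableV (f0 p) (fd i p)).
Qed.

Lemma pderivD f h i : regular f -> regular h ->
  pderiv i (fun p => f p + h p) = (fun p => pderiv i f p + pderiv i h p).
Proof.
by move=> [_ fd] [_ hd]; apply/funext => p; exact (deriveD (fd i p) (hd i p)).
Qed.

Lemma pderivM f h i : regular f -> regular h ->
  pderiv i (fun p => f p * h p) =
  (fun p => pderiv i f p * h p + f p * pderiv i h p).
Proof.
move=> [_ fd] [_ hd]; apply/funext => p.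
rewrite /pderiv (deriveM (fd i p) (hd i p)).
by rewrite /GRing.scale /= addrC mulrC.
Qed.

(** The derivative is spelt as a product containing $f^{-1}$ itself, so that closure of [Cn] under
    inverses follows from closure under products. *)
Lemma pderivV f i : (forall p, f p != 0) -> regular f ->
  pderiv i (fun p => (f p)^-1) =
  (fun p => (-1 * (f p)^-1) * (f p)^-1 * pderiv i f p).
Proof.
move=> f0 [_ fd]; apply/funext => p; rewrite /pderiv (deriveV (f0 p) (fd i p)).
by rewrite /GRing.scale /= expr2 invfM mulN1r mulNr.
Qed.

Lemma CnD m f h : Cn m f -> Cn m h -> Cn m (fun p => f p + h p).
Proof.
elim: m f h => [|m IH] f h fC hC;
  have [fr hr] := (Cn_regular fC, Cn_regular hC);
  split; try exact (regularD fr hr); first by [].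
move=> i; rewrite (pderivD i fr hr).
exact (IH _ _ (Cn_pderiv i fC) (Cn_pderiv i hC)).
Qed.

Lemma CnM m f h : Cn m f -> Cn m h -> Cn m (fun p => f p * h p).
Proof.
elim: m f h => [|m IH] f h fC hC;
  have [fr hr] := (Cn_regular fC, Cn_regular hC);
  split; try exact (regularM fr hr); first by [].
move=> i; rewrite (pderivM i fr hr); apply: CnD.
  exact (IH _ _ (Cn_pderiv i fC) (CnS hC)).
exact (IH _ _ (CnS fC) (Cn_pderiv i hC)).
Qed.

Lemma CnV m f : (forall p, f p != 0) -> Cn m f -> Cn m (fun p => (f p)^-1).
Proof.
move=> f0; elim: m => [|m IH] fC; have fr := Cn_regular fC;
  split; try exact (regularV f0 fr); first by [].
move=> i; rewrite (pderivV i f0 fr); have VC := IH (CnS fC).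
exact (CnM (CnM (CnM (Cn_cst _ _) VC) VC) (Cn_pderiv i fC)).
Qed.

Lemma smooth_cst (c : R) : smooth (fun _ : 'rV[R]_n.+1 => c).
Proof. by apply/smoothP => m; exact (Cn_cst m c). Qed.

Lemma smoothD f h : smooth f -> smooth h -> smooth (fun p => f p + h p).
Proof.
move=> /smoothP fs /smoothP hs; apply/smoothP => m.
exact (CnD (fs m) (hs m)).
Qed.

Lemma smoothM f h : smooth f -> smooth h -> smooth (fun p => f p * h p).
Proof.
move=> /smoothP fs /smoothP hs; apply/smoothP => m.
exact (CnM (fs m) (hs m)).
Qed.

Lemma smoothV f : (forall p, f p != 0) -> smooth f -> smooth (fun p => (f p)^-1).
Proof. by move=> f0 /smoothP fs; apply/smoothP => m; exact (CnV f0 (fs m)). Qed.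

Lemma smoothN f : smooth f -> smooth (fun p => - f p).
Proof.
move=> fs; rewrite (_ : (fun p => _) = (fun p => (-1) * f p)).
  exact (smoothM (smooth_cst (-1)) fs).
by apply/funext => p; rewrite mulN1r.
Qed.

Lemma smooth_sum (I : finType) (F : I -> scalar_fun R n) :
  (forall i, smooth (F i)) -> smooth (fun p => \sum_i F i p).
Proof.
move=> Fs; elim: (index_enum I) => [|i s IH].
  rewrite (_ : (fun p => _) = fun=> 0); first exact (smooth_cst 0).
  by apply/funext => p; rewrite big_nil.
rewrite (_ : (fun p => _) = fun p => F i p + \sum_(j <- s) F j p).
  exact (smoothD (Fs i) IH).
by apply/funext => p; rewrite big_cons.
Qed.

(** Directional derivatives become ordinary derivatives along a line, so that one-variable theorems
    apply to them. *)
Lemma line_quotient f p v t :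
  (fun h : R => h^-1 *: (((fun s => f (s *: v + p)) \o shift t) (h *: 1) -
     (fun s => f (s *: v + p)) t)) =
  (fun h : R => h^-1 *: ((f \o shift (t *: v + p)) (h *: v) - f (t *: v + p))).
Proof.
apply/funext => h; congr (_ *: (f _ - _)).
by rewrite /shift /= scalerDl -addrA; congr (_ *: v + _); exact: mulr1.
Qed.

Lemma is_derive_line f p v t : derivable f (t *: v + p) v ->
  is_derive t (1 : R) (fun s => f (s *: v + p)) ('D_v f (t *: v + p)).
Proof.
move=> fd; split; first by rewrite /derivable line_quotient.
by rewrite /derive line_quotient.
Qed.

Lemma is_derive_line0 f p v : derivable f p v ->
  is_derive (0 : R) 1 (fun s => f (s *: v + p)) ('D_v f p).
Proof.
have e : (0 : R) *: v + p = p by rewrite scale0r add0r.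
move=> fd; rewrite -[X in 'D_v f X]e; apply: is_derive_line.
by rewrite e.
Qed.

Lemma derive_line f p v :
  'D_v f p = 'D_1 (fun s : R => f (s *: v + p)) 0.
Proof. by rewrite {2}/derive line_quotient scale0r add0r. Qed.

Lemma derivable_line f p v :
  derivable (fun s : R => f (s *: v + p)) 0 1 -> derivable f p v.
Proof. by rewrite {1}/derivable line_quotient scale0r add0r. Qed.

Lemma is_derive_comp (g : R -> R) (dg : R) f p v :
  derivable f p v -> is_derive (f p) 1 g dg ->
  derivable (fun q => g (f q)) p v /\ 'D_v (fun q => g (f q)) p = dg * 'D_v f p.
Proof.
move=> fd gd.
have fl := is_derive_line0 fd.
have gl : is_derive ((fun s : R => f (s *: v + p)) 0) 1 g dg.
  by rewrite /= scale0r add0r.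
have [cd ce] := is_derive1_comp gl fl.
by split; [exact (derivable_line cd)|rewrite derive_line -ce].
Qed.

Lemma regular_sqrt f : (forall p, 0 < f p) -> regular f ->
  regular (fun p => Num.sqrt (f p)).
Proof.
move=> f0 [fc fd]; split=> [p|i p].
  exact (continuous_comp (fc p) (@sqrt_continuous R (f p))).
exact (is_derive_comp (fd i p) (is_derive1_sqrt (f0 p))).1.
Qed.

Lemma pderiv_sqrt f i : (forall p, 0 < f p) -> regular f ->
  pderiv i (fun p => Num.sqrt (f p)) =
  (fun p => (2 * Num.sqrt (f p))^-1 * pderiv i f p).
Proof.
move=> f0 [_ fd]; apply/funext => p.
exact (is_derive_comp (fd i p) (is_derive1_sqrt (f0 p))).2.
Qed.

(** The derivative $\partial_i f/(2\sqrt f)$ contains $\sqrt f$ undifferentiated, so order m of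
    $\sqrt f$ yields order m + 1. *)
Lemma smooth_sqrt f : (forall p, 0 < f p) -> smooth f ->
  smooth (fun p => Num.sqrt (f p)).
Proof.
move=> f0 /smoothP fs; apply/smoothP => m; move: (fs m).
elim: m => [|m IH] fC; have fr := Cn_regular fC;
  split; try exact (regular_sqrt f0 fr); first by [].
move=> i; rewrite (pderiv_sqrt i f0 fr).
apply: (CnM _ (Cn_pderiv i fC)); apply: CnV.
  by move=> p; apply: lt0r_neq0; rewrite pmulr_rgt0// sqrtr_gt0.
exact (CnM (Cn_cst m 2) (IH (CnS fC))).
Qed.

Lemma pderiv_coord (i j : 'I_n.+1) :
  pderiv i (fun p => p 0 j) = cst ((i == j)%:R : R).
Proof.
apply/funext => p; rewrite /pderiv derive_line.
rewrite (_ : (fun s : R => _) = (fun s : R => s * (i == j)%:R + p 0 j)); last first.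
  by apply/funext => s; rewrite !mxE eqxx eq_sym.
rewrite derive_val /=. rewrite /GRing.scale /= addr0 mulr1 ?mulr0 ?add0r. by [].
Qed.

Lemma regular_coord (j : 'I_n.+1) : regular (fun p => p 0 j).
Proof.
split=> [p|i p]; first exact: coord_continuous.
apply: derivable_line.
rewrite (_ : (fun s : R => _) = (fun s : R => s * (i == j)%:R + p 0 j)).
  by [].
by apply/funext => s; rewrite !mxE eqxx eq_sym.
Qed.

Lemma smooth_coord (j : 'I_n.+1) : smooth (fun p => p 0 j).
Proof.
apply/smoothP => -[|m]; (split; first exact (regular_coord j)) => // i.
by rewrite pderiv_coord; exact (Cn_cst m _).
Qed.

End SmoothFunctions.

(** * Restriction to lines and independence of a coordinate *)

Section AlongLines.
Context {R : realType} {n : nat}.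
Implicit Types (f : scalar_fun R n) (p v w : 'rV[R]_n.+1).

(** The hypothesis concerns a single line, which [L] maps affinely to a line with direction [w].
    This serves both [base] and [shrink s]. *)
Lemma derive_comp_line (m : nat) (L : 'rV[R]_m.+1 -> 'rV[R]_n.+1) f
    (p v : 'rV[R]_m.+1) w :
  (forall t, L (t *: v + p) = t *: w + L p) -> derivable f (L p) w ->
  derivable (fun q => f (L q)) p v /\ 'D_v (fun q => f (L q)) p = 'D_w f (L p).
Proof.
move=> Lv fd; have [ld lE] := is_derive_line0 fd.
have e : (fun s : R => f (L (s *: v + p))) = (fun s => f (s *: w + L p)).
  by apply/funext => s; rewrite Lv.
split; first by apply: derivable_line; rewrite e.
by rewrite derive_line e.
Qed.

Lemma derive_scale_dir (c : R) f p v : derivable f p v ->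
  derivable f p (c *: v) /\ 'D_(c *: v) f p = c * 'D_v f p.
Proof.
move=> fd.
have cd : is_derive (0 : R) 1 (fun s : R => s * c) c.
  apply: is_derive_eq; by rewrite /GRing.scale /= mulr0 add0r mulr1.
have fl : is_derive ((fun s : R => s * c) 0) 1 (fun s => f (s *: v + p)) ('D_v f p).
  by rewrite mul0r; exact (is_derive_line0 fd).
have [ld lE] := is_derive1_comp (g := fun s : R => s * c) fl cd.
have e : (fun s => f (s *: (c *: v) + p)) =
    (fun s : R => f (s *: v + p)) \o (fun s : R => s * c).
  by apply/funext => s; rewrite /= scalerA.
split; first by apply: derivable_line; rewrite e.
by rewrite derive_line e lE /GRing.scale /= mulrC.
Qed.

Lemma pderiv_invariant f i p :
  (forall t, f (t *: delta_mx 0 i + p) = f p) -> pderiv i f p = 0.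
Proof.
move=> fi; rewrite /pderiv derive_line.
rewrite (_ : (fun s : R => _) = cst (f p)); last by apply/funext.
exact (derive_cst (f p) (0 : R) 1).
Qed.

Lemma invariant_pderiv f i j :
  (forall t p, f (t *: delta_mx 0 i + p) = f p) ->
  forall t p, pderiv j f (t *: delta_mx 0 i + p) = pderiv j f p.
Proof.
move=> fi t p; rewrite /pderiv !derive_line.
rewrite (_ : (fun s : R => _) = (fun s : R => f (s *: delta_mx 0 j + p))) //.
by apply/funext => s; rewrite addrCA fi.
Qed.

Lemma pderiv0_invariant f i : regular f -> (forall p, pderiv i f p = 0) ->
  forall t p, f (t *: delta_mx 0 i + p) = f p.
Proof.
move=> [_ fd] f0 t p.
have f'0 s : is_derive s (1 : R) (fun s => f (s *: delta_mx 0 i + p)) 0.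
  by rewrite -[X in is_derive _ _ _ X](f0 (s *: delta_mx 0 i + p));
    exact (is_derive_line (fd i _)).
by rewrite (is_derive_0_is_cst t 0 f'0) scale0r add0r.
Qed.

End AlongLines.

(** * Pullback of functions along a coordinate projection *)

Section Base.
Context {R : realType} {n : nat}.
Implicit Types f : scalar_fun R n.

(** Forgets the coordinate r, which has index [ord0]; functions of (u, v) pull back along this
    map. *)
Definition base (p : 'rV[R]_n.+2) : 'rV[R]_n.+1 := \row_i p 0 (lift ord0 i).

Lemma base_continuous : continuous base.
Proof.
move=> p A /= /(nbhs_ballP (base p))[e e0 eA]; apply/nbhs_ballP.
exists e => //= q [_ pq]; apply: eA; split=> // i j.
by rewrite !mxE; exact: pq.
Qed.

Lemma baseD0 t p : base (t *: delta_mx 0 ord0 + p) = base p.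
Proof. by apply/rowP => i; rewrite !mxE mulr0 add0r. Qed.

Lemma baseDS i t p :
  base (t *: delta_mx 0 (lift ord0 i) + p) = t *: delta_mx 0 i + base p.
Proof. by apply/rowP => j; rewrite !mxE. Qed.

Lemma pderiv_base0 f : pderiv ord0 (fun p => f (base p)) = cst 0.
Proof. by apply/funext => p; apply: pderiv_invariant => t; rewrite baseD0. Qed.

Lemma pderiv_baseS f i : regular f ->
  pderiv (lift ord0 i) (fun p => f (base p)) = (fun p => pderiv i f (base p)).
Proof.
move=> [_ fd]; apply/funext => p.
exact (derive_comp_line (fun t => baseDS i t p) (fd i (base p))).2.
Qed.

Lemma regular_base f : regular f -> regular (fun p => f (base p)).
Proof.
move=> [fc fd]; split=> [p|i p].
  exact (continuous_comp (@base_continuous p) (fc (base p))).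
case: (unliftP ord0 i) => [j ->|->].
  exact (derive_comp_line (fun t => baseDS j t p) (fd j (base p))).1.
apply: derivable_line; rewrite (_ : (fun s : R => _) = cst (f (base p))).
  by [].
by apply/funext => t; rewrite baseD0.
Qed.

Lemma smooth_base f : smooth f -> smooth (fun p => f (base p)).
Proof.
move=> /smoothP fs; apply/smoothP => m; move: (fs m).
elim: m f {fs} => [|m IH] f fC; have fr := Cn_regular fC;
  split; try exact (regular_base fr); first by [].
move=> i; case: (unliftP ord0 i) => [j ->|->].
  by rewrite (pderiv_baseS j fr); exact (IH _ (Cn_pderiv j fC)).
by rewrite pderiv_base0; exact (Cn_cst m 0).
Qed.

End Base.

(** * Smooth antiderivatives and symmetry of second derivatives *)

Section ParameterIntegral.
Context {R : realType}.
Notation mu := (@lebesgue_measure R).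
Notation I01 := (`[0, 1]%classic : set R).

Lemma integrable_I01 (f : R -> R) : continuous f ->
  mu.-integrable I01 (EFin \o f).
Proof.
move=> fc; apply: continuous_compact_integrable; first exact: segment_compact.
exact: continuous_subspaceT.
Qed.

Lemma integral_I01_cst (c : R) : \int[mu]_(s in I01) c = c.
Proof.
have m1 : fine (mu I01) = 1.
  by rewrite lebesgue_measure_itv /= lte_fin ltr01 /= subr0.
by rewrite Rintegral_cst ?m1 ?mulr1.
Qed.

Section Joint.
Context {V : normedModType R} (G : R -> V -> R).
Hypothesis Gc : continuous (fun x : R * V => G x.1 x.2).

Lemma joint_continuous_time p : continuous (G ^~ p).
Proof.
by move=> s; exact: (continuous2_cvg _ (@Gc (s, p)) cvg_id (cvg_cst p)).
Qed.

(** Tube lemma: joint continuity gives closeness near each point of [0, 1], and compactness makes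
    one neighbourhood of [p] serve all [s]. *)
Lemma uniform_on_I01 p e : 0 < e ->
  \forall q \near p, forall s, I01 s -> `|G s q - G s p| < e.
Proof.
move=> e0.
have /compact_near_coveringP/(_ _ (nbhs p) (fun q s => `|G s q - G s p| < e)) :=
  @segment_compact R 0 1.
apply => s _.
have /cvgrPdist_lt/(_ _ (divr_gt0 e0 (ltr0n R 2))) := @Gc (s, p).
move=> [[U W] /= [Us Wp] UW]; exists (U, W) => // -[s' q] /= [Us' Wq].
have h1 := UW (s', q) (conj Us' Wq).
have h2 := UW (s', p) (conj Us' (nbhs_singleton Wp)).
rewrite /= in h1 h2; rewrite (splitr e).
rewrite (_ : _ - _ = - (G s p - G s' q) + (G s p - G s' p)); last by ring.
by rewrite (le_lt_trans (ler_normD _ _))// ltrD// normrN.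
Qed.

Lemma continuous_integral : continuous (fun p => \int[mu]_(s in I01) G s p).
Proof.
move=> p; apply/cvgrPdist_le => e e0.
near=> q; rewrite -RintegralB//; last 2 first.
  exact/integrable_I01/joint_continuous_time.
  exact/integrable_I01/joint_continuous_time.
have ci : mu.-integrable I01 (EFin \o (fun s => G s p - G s q)).
  apply: integrable_I01 => s.
  exact: (cvgB (@joint_continuous_time p s) (@joint_continuous_time q s)).
apply: (le_trans (le_normr_Rintegral _ ci)) => //.
rewrite -(integral_I01_cst e).
apply: le_Rintegral => //.
- apply: integrable_I01 => s; apply: cvg_norm.
  exact: (cvgB (@joint_continuous_time p s) (@joint_continuous_time q s)).
- by apply: integrable_I01 => s; exact: cvg_cst.
- near: q; apply: filterS (uniform_on_I01 p e0) => q h s /h /ltW.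
  by rewrite distrC.
Unshelve. all: by end_near. Qed.

End Joint.

(** Dominated convergence: by [uniform_on_I01] with bound 1, for t near 0 the derivative [dG s t] is
    at most [|dG s 0| + 1] in absolute value, which is integrable in [s]. *)
Lemma derive_integral_line (G dG : R -> R -> R) :
  continuous (fun x : R * R => G x.1 x.2) ->
  continuous (fun x : R * R => dG x.1 x.2) ->
  (forall s t : R, is_derive t (1 : R) (G s) (dG s t)) ->
  is_derive (0 : R) (1 : R) (fun t : R => \int[mu]_(s in I01) G s t)
    (\int[mu]_(s in I01) dG s 0).
Proof.
move=> Gc dGc Gd.
have /nbhs_ballP[d /= d0 dP] := uniform_on_I01 dGc 0 (ltr01 : 0 < 1 :> R).
have near0 t : `]- d, d[%classic t -> forall s, I01 s -> `|dG s t - dG s 0| < 1.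
  move=> /=; rewrite in_itv/= -ltr_norml => td; apply: dP.
  by rewrite /ball/= sub0r normrN.
have d0' : `]- d, d[%classic (0 : R) by rewrite /= in_itv/= oppr_lt0 d0.
have intG t : `]- d, d[%classic t -> mu.-integrable I01 (EFin \o (fun y => G y t)).
  by move=> _; exact/integrable_I01/joint_continuous_time.
have dnG t s : `]- d, d[%classic t -> I01 s ->
    derivable (fun x : R => G s x) t (1 : R).
  by move=> _ _; have [] := Gd s t.
pose B s := `|dG s 0| + 1.
have B0 s : 0 <= B s by rewrite addr_ge0.
have intB : mu.-integrable I01 (EFin \o B).
  apply: integrable_I01 => s; apply: cvgD; last exact: cvg_cst.
  by apply: cvg_norm; exact: joint_continuous_time.
have partialE t s : partial1of2 (fun x y => G y x) t s = dG s t.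
  by rewrite partial1of2E; exact: derive_val.
have GB t s : `]- d, d[%classic t -> I01 s ->
    `|partial1of2 (fun x y => G y x) t s| <= B s.
  move=> td sI; rewrite partialE /B -[X in `|X|](subrK (dG s 0)) addrC.
  by rewrite (le_trans (ler_normD _ _))// lerD2l ltW// near0.
(* [Gt] puts the parameter first, the argument order expected by the theorems on differentiation
   under the integral. *)
have mI : measurable I01 by exact: measurable_itv.
pose Gt x y := G y x; split.
  exact (derivable_under_integral (mu := mu) (f := Gt) mI d0' intG dnG B0 intB GB).
rewrite -derive1E.
rewrite (differentiation_under_integral (mu := mu) (f := Gt)
  mI d0' intG dnG B0 intB GB).
by congr Rintegral; apply/funext => s; rewrite partialE.
Qed.

(** Restriction to the line $t \mapsto tv + p$ reduces this to [derive_integral_line]. *)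
Lemma derive_integral (n : nat) (G dG : R -> 'rV[R]_n.+1 -> R) p v :
  continuous (fun x : R * 'rV[R]_n.+1 => G x.1 x.2) ->
  continuous (fun x : R * 'rV[R]_n.+1 => dG x.1 x.2) ->
  (forall s q, derivable (G s) q v) -> (forall s q, 'D_v (G s) q = dG s q) ->
  derivable (fun q => \int[mu]_(s in I01) G s q) p v /\
  'D_v (fun q => \int[mu]_(s in I01) G s q) p = \int[mu]_(s in I01) dG s p.
Proof.
move=> Gc dGc Gd GdE.
have linec (F : R -> 'rV[R]_n.+1 -> R) :
    continuous (fun x : R * 'rV[R]_n.+1 => F x.1 x.2) ->
    continuous (fun x : R * R => F x.1 (x.2 *: v + p)).
  move=> Fc x; apply: (continuous2_cvg _ (Fc (x.1, x.2 *: v + p))).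
    exact: cvg_fst.
  by apply: cvgD; [apply: cvgZl; exact: cvg_snd|exact: cvg_cst].
pose Gl s (t : R) := G s (t *: v + p); pose dGl s (t : R) := dG s (t *: v + p).
have Gld s t : is_derive t (1 : R) (Gl s) (dGl s t).
  by rewrite /dGl -GdE; exact (is_derive_line (Gd s _)).
have [d dE] := derive_integral_line (G := Gl) (dG := dGl)
  (linec G Gc) (linec dG dGc) Gld.
split; first exact: derivable_line.
by rewrite derive_line dE /dGl scale0r add0r.
Qed.

End ParameterIntegral.

(** * Weighted means along coordinate segments *)

Section Primitive.
Context {R : realType} {n : nat} (i : 'I_n.+1).
Notation mu := (@lebesgue_measure R).
Notation I01 := (`[0, 1]%classic : set R).
Implicit Types (f : scalar_fun R n) (w : R -> R) (p : 'rV[R]_n.+1).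

(** Multiplies the [i]-th coordinate by [s]; for [s] in [0, 1] it runs along the segment from the
    hyperplane $x_i = 0$ to [p]. *)
Definition shrink (s : R) p : 'rV[R]_n.+1 :=
  p + ((s - 1) * p 0 i) *: delta_mx 0 i.

Lemma shrink1 p : shrink 1 p = p.
Proof. by rewrite /shrink subrr mul0r scale0r addr0. Qed.

Lemma shrinkD s t j p : shrink s (t *: delta_mx 0 j + p) =
  t *: ((if j == i then s else 1) *: delta_mx 0 j) + shrink s p.
Proof.
rewrite /shrink !mxE eqxx /= [i == j]eq_sym; case: eqVneq => [->|ji] /=.
  rewrite mulr1 mulrDr scalerDl addrACA scalerA -scalerDl.
  by congr (_ *: _ + _); ring.
by rewrite mulr0 add0r scale1r addrA.
Qed.

Lemma shrink_line s p :
  shrink s p = s *: (p 0 i *: delta_mx 0 i) + (p - p 0 i *: delta_mx 0 i).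
Proof.
by rewrite /shrink mulrBl mul1r scalerBl scalerA addrC addrA addrAC -addrA.
Qed.

Lemma shrink_continuous :
  continuous (fun x : R * 'rV[R]_n.+1 => shrink x.1 x.2).
Proof.
move=> x; apply: cvgD; first exact: cvg_snd.
apply: cvgZr_tmp; apply: cvgM.
  by apply: cvgB; [exact: cvg_fst|exact: cvg_cst].
apply: (@continuous_comp _ _ _ snd (fun q : 'rV[R]_n.+1 => q 0 i)).
  exact: cvg_snd.
exact: coord_continuous.
Qed.

(** The weight makes the family stable under differentiation: a derivative in direction [i] brings
    out a factor [s], which [ray_weight] absorbs. *)
Definition ray_mean w f : scalar_fun R n := fun p =>
  \int[mu]_(s in I01) (w s * f (shrink s p)).

Lemma ray_mean_integrand_continuous w f : continuous w -> continuous f ->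
  continuous (fun x : R * 'rV[R]_n.+1 => w x.1 * f (shrink x.1 x.2)).
Proof.
move=> wc fc x; apply: cvgM.
  exact: (continuous_comp (@cvg_fst _ _ _ _ _) (wc x.1)).
exact: (continuous_comp (@shrink_continuous x) (fc (shrink x.1 x.2))).
Qed.

Definition ray_weight (j : 'I_n.+1) w : R -> R :=
  fun s => w s * (if j == i then s else 1).

Lemma ray_weight_continuous j w : continuous w -> continuous (ray_weight j w).
Proof.
move=> wc s; apply: cvgM; first exact: wc.
by case: (j == i); [exact: cvg_id|exact: cvg_cst].
Qed.

Lemma ray_mean_derive w f j p : continuous w -> Cn 1 f ->
  derivable (ray_mean w f) p (delta_mx 0 j) /\
  pderiv j (ray_mean w f) p = ray_mean (ray_weight j w) (pderiv j f) p.
Proof.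
move=> wc fC; have [fc fd] := Cn_regular fC.
have [f'c _] := Cn_regular (Cn_pderiv j fC).
have wjc := @ray_weight_continuous j w wc.
pose c s := if j == i then s else 1 : R.
have fsd s q := derive_scale_dir (c s) (fd j (shrink s q)).
have fs s q := derive_comp_line (fun t => shrinkD s t j q) (fsd s q).1.
have cd s q : derivable (fun=> w s : R) q (delta_mx 0 j : 'rV[R]_n.+1).
  exact: derivable_cst.
apply: (@derive_integral R n (fun s q => w s * f (shrink s q))
  (fun s q => ray_weight j w s * pderiv j f (shrink s q))).
- exact: ray_mean_integrand_continuous.
- exact: ray_mean_integrand_continuous.
- by move=> s q; exact (derivableM (cd s q) (fs s q).1).
- move=> s q; rewrite (deriveM (cd s q) (fs s q).1) (fs s q).2 (fsd s q).2.
  by rewrite derive_cst scaler0 addr0 /GRing.scale /= mulrA.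
Qed.

Lemma ray_mean_continuous w f : continuous w -> continuous f ->
  continuous (ray_mean w f).
Proof.
move=> wc fc; exact: (continuous_integral (ray_mean_integrand_continuous wc fc)).
Qed.

(** One order is lost because differentiation under the integral uses a continuous derivative of
    [f]. The induction runs over all weights, as each derivative may change the weight. *)
Lemma Cn_ray_mean m w f : continuous w -> Cn m.+1 f -> Cn m (ray_mean w f).
Proof.
elim: m w f => [|m IH] w f wc fC.
  split=> //; split; first exact (ray_mean_continuous wc (Cn_regular fC).1).
  by move=> j p; exact (ray_mean_derive j p wc fC).1.
have fC1 : Cn 1 f.
  split=> [|j]; first exact (Cn_regular fC).
  by split=> //; exact (Cn_regular (Cn_pderiv j fC)).
split.
  split; first exact (ray_mean_continuous wc (Cn_regular fC).1).
  by move=> j p; exact (ray_mean_derive j p wc fC1).1.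
move=> j; rewrite (_ : pderiv j _ = ray_mean (ray_weight j w) (pderiv j f)).
  exact (IH _ _ (ray_weight_continuous wc) (Cn_pderiv j fC)).
by apply/funext => p; exact (ray_mean_derive j p wc fC1).2.
Qed.

End Primitive.

(** * Antiderivatives and commutation of partial derivatives *)

Section Antiderivative.
Context {R : realType} {n : nat}.
Notation mu := (@lebesgue_measure R).
Notation I01 := (`[0, 1]%classic : set R).
Implicit Types (f : scalar_fun R n) (p : 'rV[R]_n.+1).

(* The integral of [f] along the [i]-th coordinate from 0 to [p 0 i], rescaled to
   the fixed interval [0, 1] so that all derivatives pass under the integral. *)
Definition primitive i f : scalar_fun R n :=
  fun p => p 0 i * ray_mean i (fun=> 1) f p.

Lemma smooth_Cn m f : smooth f -> Cn m f.
Proof. by move=> /smoothP. Qed.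

Lemma continuous_cst1 : continuous (fun _ : R => 1 : R).
Proof. by move=> s; exact: cvg_cst. Qed.

Lemma regular_ray_mean i w f : continuous w -> smooth f ->
  regular (ray_mean i w f).
Proof.
by move=> wc fs; exact (Cn_regular (Cn_ray_mean i (m := 0) wc (smooth_Cn 1 fs))).
Qed.

Lemma smooth_primitive i f : smooth f -> smooth (primitive i f).
Proof.
move=> fs; apply: smoothM; first exact: smooth_coord.
by apply/smoothP => m; exact (Cn_ray_mean i continuous_cst1 (smooth_Cn m.+1 fs)).
Qed.

Lemma pderiv_primitive_neq i j f : j != i -> smooth f ->
  pderiv j (primitive i f) = primitive i (pderiv j f).
Proof.
move=> ji fs.
rewrite (pderivM _ (regular_coord i) (regular_ray_mean i continuous_cst1 fs)).
apply/funext => p; rewrite pderiv_coord (negPf ji) mul0r add0r.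
rewrite (ray_mean_derive i j p continuous_cst1 (smooth_Cn 1 fs)).2.
rewrite (_ : ray_weight i j _ = fun=> 1) //.
by apply/funext => s; rewrite /ray_weight (negPf ji) mulr1.
Qed.

(* Both sides are [\int_0^1 d/ds (s f(T_s p)) ds], where [T_s] multiplies the
   [i]-th coordinate by [s]. *)
Lemma ray_mean_by_parts i f p : smooth f ->
  ray_mean i (fun=> 1) f p + p 0 i * ray_mean i id (pderiv i f) p = f p.
Proof.
move=> fs; have [fc fd] := smooth_regular fs.
have [f'c _] := smooth_regular (smooth_pderiv i fs).
have idc : continuous (id : R -> R) by move=> s; exact: cvg_id.
pose u (s : R) := f (shrink i s p).
pose u' (s : R) := p 0 i * pderiv i f (shrink i s p).
have ud s : is_derive s (1 : R) u (u' s).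
  have [dd dE] := derive_scale_dir (p 0 i) (fd i (shrink i s p)).
  rewrite /u' -dE.
  have e : u = fun t => f (t *: (p 0 i *: delta_mx 0 i) +
      (p - p 0 i *: delta_mx 0 i)).
    by apply/funext => t; rewrite /u shrink_line.
  by rewrite e shrink_line; apply: is_derive_line; rewrite -shrink_line.
have vd s : is_derive s (1 : R) (fun t => t * u t) (u s + s * u' s).
  have ids := is_derive_id s (1 : R).
  apply: is_derive_eq (is_deriveM ids (ud s)) _.
  by rewrite /GRing.scale /= mulr1 addrC.
have F1c : continuous (fun s => (1 : R) * u s).
  exact (joint_continuous_time (p := p) (G := fun (s : R) q => 1 * f (shrink i s q))
    (ray_mean_integrand_continuous continuous_cst1 fc)).
have F2c : continuous (fun s : R => s * pderiv i f (shrink i s p)).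
  exact (joint_continuous_time (p := p)
    (G := fun (s : R) q => s * pderiv i f (shrink i s q))
    (ray_mean_integrand_continuous idc f'c)).
have uc : continuous u.
  rewrite (_ : u = fun s => 1 * u s) //.
  by apply/funext => s; rewrite mul1r.
have vc : continuous (fun s : R => u s + s * u' s).
  move=> s; apply: cvgD; first exact: uc.
  rewrite (_ : (fun t => _) = (fun t => p 0 i * (t * pderiv i f (shrink i t p)))).
    by rewrite mulrCA; apply: cvgM; [exact: cvg_cst|exact: F2c].
  by apply/funext => t; rewrite mulrCA.
have vuc : continuous (fun s : R => s * u s).
  by move=> s; apply: cvgM; [exact: cvg_id|exact: uc].
have ftc : (\int[mu]_(s in I01) (u s + s * u' s)%:E = (f p)%:E)%E.
  rewrite (@continuous_FTC2 R (fun s => u s + s * u' s) (fun t => t * u t)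
    0 1 ltr01).
  - by rewrite /u shrink1 mul1r mul0r sube0.
  - exact: continuous_subspaceT.
  - split=> [s _||]; first by have [] := vd s.
      exact: cvg_at_right_filter (vuc 0).
    exact: cvg_at_left_filter (vuc 1).
  - by move=> s _; rewrite derive1E; exact: derive_val.
rewrite -RintegralZl; [|exact: measurable_itv|exact: integrable_I01].
rewrite -RintegralD; first last.
- by apply: integrable_I01 => s; apply: cvgM; [exact: cvg_cst|exact: F2c].
- exact: integrable_I01.
- exact: measurable_itv.
rewrite -[RHS]/(fine (f p)%:E) -ftc; congr fine.
by apply: eq_integral => s _; rewrite mul1r mulrCA.
Qed.

(** Differentiating in direction [i] turns the weight 1 into [s], so the product rule produces
    exactly the sum in [ray_mean_by_parts]. *)
Lemma pderiv_primitive i f : smooth f -> pderiv i (primitive i f) = f.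
Proof.
move=> fs.
rewrite (pderivM _ (regular_coord i) (regular_ray_mean i continuous_cst1 fs)).
apply/funext => p; rewrite pderiv_coord eqxx mul1r.
rewrite (ray_mean_derive i i p continuous_cst1 (smooth_Cn 1 fs)).2.
rewrite (_ : ray_weight i i _ = id); first exact: ray_mean_by_parts.
by apply/funext => s; rewrite /ray_weight eqxx mul1r.
Qed.

Lemma primitive0 i f p : p 0 i = 0 -> primitive i f p = 0.
Proof. by rewrite /primitive => ->; rewrite mul0r. Qed.

(* Subtracting from [f] a primitive of its [i]-th derivative leaves a function
   that does not depend on the [i]-th coordinate, and primitives along the
   [i]-th coordinate commute with the other derivatives. *)
Lemma pderivC i j f : smooth f -> pderiv i (pderiv j f) = pderiv j (pderiv i f).
Proof.
move=> fs; case: (eqVneq j i) => [->//|ji].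
have f's := smooth_pderiv i fs; have Ps := smooth_primitive i f's.
have Ns := smoothN Ps.
pose h : scalar_fun R n := fun p => f p + - primitive i (pderiv i f) p.
have hs : smooth h by exact: smoothD.
have h0 p : pderiv i h p = 0.
  rewrite /h (pderivD _ (smooth_regular fs) (smooth_regular Ns)).
  rewrite (_ : (fun q => - _) = (fun q => cst (-1) q * primitive i (pderiv i f) q)).
    rewrite (pderivM _ (smooth_regular (smooth_cst (-1))) (smooth_regular Ps)).
    by rewrite pderiv_primitive // pderiv_cst /= mul0r add0r mulN1r subrr.
  by apply/funext => q; rewrite mulN1r.
have fE : f = fun p => h p + primitive i (pderiv i f) p.
  by apply/funext => p; rewrite /h subrK.
rewrite {1}fE (pderivD _ (smooth_regular hs) (smooth_regular Ps)).
rewrite pderiv_primitive_neq //.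
rewrite pderivD; [|exact/smooth_regular/smooth_pderiv|]; last first.
  exact/smooth_regular/smooth_primitive/smooth_pderiv.
rewrite pderiv_primitive; last exact: smooth_pderiv.
apply/funext => p; have hi := pderiv0_invariant (smooth_regular hs) h0.
rewrite (_ : pderiv i (pderiv j h) p = 0); first by rewrite add0r.
exact (pderiv_invariant (fun t => invariant_pderiv j hi t p)).
Qed.

End Antiderivative.

(** * Curvature of a metric in a moving frame *)

Section MatrixFields.
Context {R : realType} {n : nat}.
Implicit Types p : 'rV[R]_n.+1.

Definition mxsmooth {a b} (M : 'rV[R]_n.+1 -> 'M[R]_(a, b)) :=
  forall r c, smooth (fun p => M p r c).

Definition mxderiv {a b} i (M : 'rV[R]_n.+1 -> 'M[R]_(a, b)) :
    'rV[R]_n.+1 -> 'M[R]_(a, b) :=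
  fun p => \matrix_(r, c) pderiv i (fun q => M q r c) p.

Lemma pderiv_sum (I : finType) (F : I -> scalar_fun R n) i p :
  (forall j, smooth (F j)) ->
  pderiv i (fun q => \sum_j F j q) p = \sum_j pderiv i (F j) p.
Proof.
move=> Fs; suff: smooth (fun q => \sum_j F j q) /\
    pderiv i (fun q => \sum_j F j q) p = \sum_j pderiv i (F j) p by case.
elim: (index_enum I) => [|j s [IHs IH]].
  rewrite (_ : (fun q => _) = cst 0) ?big_nil.
    by split; [exact (smooth_cst 0)|rewrite pderiv_cst].
  by apply/funext => q; rewrite big_nil.
rewrite (_ : (fun q => _) = fun q => F j q + \sum_(k <- s) F k q); last first.
  by apply/funext => q; rewrite big_cons.
split; first exact (smoothD (Fs j) IHs).
rewrite (pderivD _ (smooth_regular (Fs j)) (smooth_regular IHs)) IH.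
by rewrite big_cons.
Qed.

Lemma mxsmoothM {a b c} (M : 'rV[R]_n.+1 -> 'M[R]_(a, b))
    (N : 'rV[R]_n.+1 -> 'M[R]_(b, c)) :
  mxsmooth M -> mxsmooth N -> mxsmooth (fun p => M p *m N p).
Proof.
move=> Ms Ns r s; rewrite (_ : (fun p => _) = fun p => \sum_j M p r j * N p j s).
  by apply: smooth_sum => j; exact (smoothM (Ms r j) (Ns j s)).
by apply/funext => p; rewrite mxE.
Qed.

Lemma mxderivM {a b c} (M : 'rV[R]_n.+1 -> 'M[R]_(a, b))
    (N : 'rV[R]_n.+1 -> 'M[R]_(b, c)) i p : mxsmooth M -> mxsmooth N ->
  mxderiv i (fun p => M p *m N p) p =
  mxderiv i M p *m N p + M p *m mxderiv i N p.
Proof.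
move=> Ms Ns; apply/matrixP => r s; rewrite !mxE -big_split /=.
rewrite (_ : (fun q => _) = fun q => \sum_j M q r j * N q j s); last first.
  by apply/funext => q; rewrite mxE.
rewrite pderiv_sum => [|j]; last exact (smoothM (Ms r j) (Ns j s)).
apply: eq_bigr => j _; rewrite !mxE.
by rewrite (pderivM _ (smooth_regular (Ms r j)) (smooth_regular (Ns j s))).
Qed.

Lemma mxsmoothD {a b} (M N : 'rV[R]_n.+1 -> 'M[R]_(a, b)) :
  mxsmooth M -> mxsmooth N -> mxsmooth (fun p => M p + N p).
Proof.
move=> Ms Ns r s; rewrite (_ : (fun p => _) = fun p => M p r s + N p r s).
  exact (smoothD (Ms r s) (Ns r s)).
by apply/funext => p; rewrite mxE.
Qed.

Lemma mxderivD {a b} (M N : 'rV[R]_n.+1 -> 'M[R]_(a, b)) i p :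
  mxsmooth M -> mxsmooth N ->
  mxderiv i (fun p => M p + N p) p = mxderiv i M p + mxderiv i N p.
Proof.
move=> Ms Ns; apply/matrixP => r s; rewrite !mxE.
rewrite (_ : (fun q => _) = fun q => M q r s + N q r s).
  by rewrite (pderivD _ (smooth_regular (Ms r s)) (smooth_regular (Ns r s))).
by apply/funext => q; rewrite mxE.
Qed.

Lemma mxsmoothZ {a b} (f : scalar_fun R n) (M : 'rV[R]_n.+1 -> 'M[R]_(a, b)) :
  smooth f -> mxsmooth M -> mxsmooth (fun p => f p *: M p).
Proof.
move=> fs Ms r s; rewrite (_ : (fun p => _) = fun p => f p * M p r s).
  exact (smoothM fs (Ms r s)).
by apply/funext => p; rewrite mxE.
Qed.

Lemma mxderivZ {a b} (f : scalar_fun R n) (M : 'rV[R]_n.+1 -> 'M[R]_(a, b)) i p :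
  smooth f -> mxsmooth M ->
  mxderiv i (fun p => f p *: M p) p = pderiv i f p *: M p + f p *: mxderiv i M p.
Proof.
move=> fs Ms; apply/matrixP => r s; rewrite !mxE.
rewrite (_ : (fun q => _) = fun q => f q * M q r s).
  by rewrite (pderivM _ (smooth_regular fs) (smooth_regular (Ms r s))).
by apply/funext => q; rewrite mxE.
Qed.

Lemma mxsmooth_sum {a b} (I : finType) (M : I -> 'rV[R]_n.+1 -> 'M[R]_(a, b)) :
  (forall j, mxsmooth (M j)) -> mxsmooth (fun p => \sum_j M j p).
Proof.
move=> Ms r s; rewrite (_ : (fun p => _) = fun p => \sum_j M j p r s).
  by apply: smooth_sum => j; exact (Ms j r s).
by apply/funext => p; rewrite summxE.
Qed.

Lemma mxderiv_sum {a b} (I : finType) (M : I -> 'rV[R]_n.+1 -> 'M[R]_(a, b)) i p :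
  (forall j, mxsmooth (M j)) ->
  mxderiv i (fun p => \sum_j M j p) p = \sum_j mxderiv i (M j) p.
Proof.
move=> Ms; apply/matrixP => r s; rewrite !mxE summxE.
rewrite (_ : (fun q => _) = fun q => \sum_j M j q r s).
  rewrite pderiv_sum => [|j]; last exact (Ms j r s).
  by apply: eq_bigr => j _; rewrite mxE.
by apply/funext => q; rewrite summxE.
Qed.

Lemma mxsmooth_deriv {a b} i (M : 'rV[R]_n.+1 -> 'M[R]_(a, b)) :
  mxsmooth M -> mxsmooth (mxderiv i M).
Proof.
move=> Ms r s; rewrite (_ : (fun p => _) = pderiv i (fun q => M q r s)).
  exact (smooth_pderiv i (Ms r s)).
by apply/funext => p; rewrite mxE.
Qed.

Lemma mxderivC {a b} i j (M : 'rV[R]_n.+1 -> 'M[R]_(a, b)) p : mxsmooth M ->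
  mxderiv i (mxderiv j M) p = mxderiv j (mxderiv i M) p.
Proof.
move=> Ms; apply/matrixP => r s; rewrite [LHS]mxE [RHS]mxE.
have mxdE k : (fun q => mxderiv k M q r s) = pderiv k (fun q => M q r s).
  by apply/funext => q; rewrite mxE.
by rewrite (mxdE i) (mxdE j) (pderivC i j (Ms r s)).
Qed.

Lemma mxsmooth_tr {a b} (M : 'rV[R]_n.+1 -> 'M[R]_(a, b)) :
  mxsmooth M -> mxsmooth (fun p => (M p)^T).
Proof.
move=> Ms r s; rewrite (_ : (fun p => _) = fun p => M p s r); first exact (Ms s r).
by apply/funext => p; rewrite mxE.
Qed.

Lemma mxderiv_tr {a b} i (M : 'rV[R]_n.+1 -> 'M[R]_(a, b)) p :
  mxderiv i (fun q => (M q)^T) p = (mxderiv i M p)^T.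
Proof.
apply/matrixP => r s; rewrite !mxE.
by rewrite (_ : (fun q => _) = fun q => M q s r) //; apply/funext => q; rewrite mxE.
Qed.

Lemma mxsmooth_vfield (X : vfield R n) : smooth_vfield X -> mxsmooth X.
Proof. by move=> Xs r; rewrite (ord1 r); exact Xs. Qed.

End MatrixFields.

(* [theta p i a] is the value of the [a]-th coframe form on the [i]-th coordinate
   field, and [H] is the matrix of the dual frame.  A field with frame components
   [y] (a row) has covariant derivative [d y + y A]: the entry [A i p b a] is
   omega^a_b(d/dx_i) in the usual notation for connection forms. *)
Section MovingFrame.
Context {R : realType} {n : nat}.
Implicit Types (p : 'rV[R]_n.+1) (X Y Z : vfield R n).
Variables (theta H : 'rV[R]_n.+1 -> 'M[R]_n.+1).
Variable A : 'I_n.+1 -> 'rV[R]_n.+1 -> 'M[R]_n.+1.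
Hypothesis theta_smooth : mxsmooth theta.
Hypothesis H_smooth : mxsmooth H.
Hypothesis A_smooth : forall i, mxsmooth (A i).
Hypothesis thetaK : forall p, theta p *m H p = 1%:M.
Hypothesis A_skew : forall i p, (A i p)^T = - A i p.
Hypothesis A_torsion_free : forall i j p k,
  (mxderiv i theta p + theta p *m A i p) j k =
  (mxderiv j theta p + theta p *m A j p) i k.

(** The metric $\sum_a e^a \otimes e^a$, for which the coframe is orthonormal. *)
Definition frame_metric : tensor2 R n := fun p => theta p *m (theta p)^T.

Lemma dual_frame_coframe p : H p *m theta p = 1%:M.
Proof. exact: mulmx1C (thetaK p). Qed.

Lemma inner_frame X Y p :
  inner frame_metric X Y p =
  ((X p *m theta p) *m (Y p *m theta p)^T) 0 0.
Proof.
rewrite trmx_mul mulmxA -(mulmxA (X p)) -/(frame_metric p) mxE.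
under [RHS]eq_bigr do rewrite !mxE mulr_suml.
rewrite exchange_big; apply: eq_bigr => i _; apply: eq_bigr => j _ /=.
by rewrite mulrAC (mulrC (X p 0 i)) mulrAC.
Qed.

Lemma frame_metric_riemannian : riemannian_metric frame_metric.
Proof.
split=> [|p|p v v0].
- exact (mxsmoothM theta_smooth (mxsmooth_tr theta_smooth)).
- by rewrite /frame_metric trmx_mul trmxK.
rewrite -[X in 0 < X]/(inner frame_metric (fun=> v) (fun=> v) p) inner_frame.
set w := v *m theta p.
have w0 : w != 0.
  apply: contraNneq v0 => w0.
  by rewrite -[v]mulmx1 -(thetaK p) mulmxA -/w w0 mul0mx.
rewrite mxE; under eq_bigr do rewrite [w^T _ _]mxE -expr2.
rewrite lt0r sumr_ge0 => [|i _]; last exact: sqr_ge0.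
rewrite andbT; apply: contraNneq w0 => /eqP.
rewrite psumr_eq0 => [/allP w0|i _]; last exact: sqr_ge0.
apply/eqP/rowP => i; rewrite [RHS]mxE; apply/eqP; rewrite -sqrf_eq0.
exact: w0 (mem_index_enum i).
Qed.

Lemma invmx_frame_metric p : invmx (frame_metric p) = (H p)^T *m H p.
Proof.
have e : frame_metric p *m ((H p)^T *m H p) = 1%:M.
  rewrite /frame_metric mulmxA -(mulmxA (theta p)) -trmx_mul.
  rewrite dual_frame_coframe trmx1 mulmx1.
  exact: thetaK.
by rewrite -[LHS]mulmx1 -e mulKmx // (metric_unit frame_metric_riemannian).
Qed.

(** The connection matrix [A i] transformed from the frame to coordinates; its entry (j, k) turns
    out to be $\Gamma^k_{ij}$. *)
Definition frame_gamma i p := (mxderiv i theta p + theta p *m A i p) *m H p.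

Lemma frame_gammaE i p :
  frame_gamma i p *m theta p = mxderiv i theta p + theta p *m A i p.
Proof. by rewrite /frame_gamma -mulmxA dual_frame_coframe mulmx1. Qed.

Lemma frame_gammaC i j p k : frame_gamma i p j k = frame_gamma j p i k.
Proof.
by rewrite !mxE; apply: eq_bigr => l _; rewrite A_torsion_free.
Qed.

(** Metric compatibility: since [A i p] is skew, $\theta A\theta^T$ and its transpose cancel. *)
Lemma frame_metric_deriv i p : mxderiv i frame_metric p =
  frame_gamma i p *m frame_metric p + (frame_gamma i p *m frame_metric p)^T.
Proof.
rewrite (mxderivM _ _ theta_smooth (mxsmooth_tr theta_smooth)) mxderiv_tr.
rewrite /frame_metric mulmxA frame_gammaE trmx_mul trmxK linearD /= trmx_mul A_skew.
rewrite mulmxDl mulmxDr mulNmx mulmxN -[in RHS]mulmxA.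
by rewrite addrACA subrr addr0.
Qed.

(** With the upper index lowered, compatibility reads $\partial_a g_{bc} = G_{abc} + G_{acb}$ and
    torsion-freeness $G_{abc} = G_{bac}$. The Christoffel combination then collapses to
    $2G_{ijl}$. *)
Lemma christoffel_frame k i j p :
  christoffel frame_metric k i j p = frame_gamma i p j k.
Proof.
pose G i := frame_gamma i p *m frame_metric p.
have dg a b c : pderiv a (fun q => frame_metric q b c) p = G a b c + G a c b.
  transitivity (mxderiv a frame_metric p b c); first by rewrite [RHS]mxE.
  by rewrite frame_metric_deriv mxE [X in _ + X = _]mxE.
have GC a b c : G a b c = G b a c.
  by rewrite !mxE; apply: eq_bigr => l _; rewrite frame_gammaC.
have gm := frame_metric_riemannian.
transitivity ((G i *m invmx (frame_metric p)) j k); last first.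
  by rewrite /G mulmxK // metric_unit.
rewrite mxE /christoffel mulr_sumr; apply: eq_bigr => l _.
rewrite !dg (GC j i l) (GC l i j) (GC l j i).
have -> : invmx (frame_metric p) k l = invmx (frame_metric p) l k.
  by rewrite -[in LHS](Defs.metric_sym gm p) -trmx_inv mxE.
by field.
Qed.

Definition covar X (y : vfield R n) : vfield R n := fun p =>
  \sum_i X p 0 i *: (mxderiv i y p + y p *m A i p).

Lemma vfield_frame_smooth Y : smooth_vfield Y -> mxsmooth (fun q => Y q *m theta q).
Proof. by move=> Ys; exact (mxsmoothM (mxsmooth_vfield Ys) theta_smooth). Qed.

Lemma levi_civita_frame X Y p : smooth_vfield Y ->
  levi_civita frame_metric X Y p *m theta p = covar X (fun q => Y q *m theta q) p.
Proof.
move=> Ys; have Yms := mxsmooth_vfield Ys.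
have -> : levi_civita frame_metric X Y p =
    \sum_i X p 0 i *: (mxderiv i Y p + Y p *m frame_gamma i p).
  apply/rowP => k; rewrite mxE summxE -big_split /=; apply: eq_bigr => i _.
  rewrite [RHS]mxE [in RHS]mxE [mxderiv _ _ _ _ _]mxE mulrDr; congr (_ + _).
  rewrite [in RHS]mxE mulr_sumr; apply: eq_bigr => j _.
  by rewrite christoffel_frame; ring.
rewrite mulmx_suml; apply: eq_bigr => i _; rewrite -scalemxAl; congr (_ *: _).
rewrite mulmxDl -mulmxA frame_gammaE mulmxDr mulmxA addrA.
by rewrite (mxderivM _ _ Yms theta_smooth).
Qed.

Lemma smooth_covar X y : smooth_vfield X -> mxsmooth y -> mxsmooth (covar X y).
Proof.
move=> Xs ys; apply: mxsmooth_sum => i; apply: mxsmoothZ; first exact (Xs i).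
exact (mxsmoothD (mxsmooth_deriv i ys) (mxsmoothM ys (@A_smooth i))).
Qed.

Lemma levi_civita_smooth X Y : smooth_vfield X -> smooth_vfield Y ->
  smooth_vfield (levi_civita frame_metric X Y).
Proof.
move=> Xs Ys k.
have -> : levi_civita frame_metric X Y =
    fun p => covar X (fun q => Y q *m theta q) p *m H p.
  by apply/funext => p; rewrite -levi_civita_frame // -mulmxA thetaK mulmx1.
exact (mxsmoothM (smooth_covar Xs (vfield_frame_smooth Ys)) H_smooth 0 k).
Qed.

(** Components of the curvature form $dA + A \wedge A$; the products stand in reverse order because
    frame components are rows, acted on from the right. *)
Definition frame_curv i j p : 'M[R]_n.+1 :=
  mxderiv i (A j) p - mxderiv j (A i) p + A j p *m A i p - A i p *m A j p.

Definition coord_covar i (y : vfield R n) : vfield R n :=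
  fun p => mxderiv i y p + y p *m A i p.

Lemma smooth_coord_covar i y : mxsmooth y -> mxsmooth (coord_covar i y).
Proof.
move=> ys; exact (mxsmoothD (mxsmooth_deriv i ys) (mxsmoothM ys (@A_smooth i))).
Qed.

(** Second derivatives of [y] commute and the first-order terms are symmetric in i and j, so only
    the terms without derivatives of [y] survive. *)
Lemma coord_covarC i j y p : mxsmooth y ->
  coord_covar i (coord_covar j y) p - coord_covar j (coord_covar i y) p =
  y p *m frame_curv i j p.
Proof.
move=> ys.
have expand k l : coord_covar k (coord_covar l y) p =
    mxderiv k (mxderiv l y) p + (mxderiv k y p *m A l p + mxderiv l y p *m A k p)
    + y p *m (mxderiv k (A l) p + A l p *m A k p).
  rewrite {1}/coord_covar
    (mxderivD _ _ (mxsmooth_deriv l ys) (mxsmoothM ys (@A_smooth l))).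
  rewrite (mxderivM _ _ ys (@A_smooth l)) mulmxDr mulmxDl mulmxA.
  by rewrite !addrA; congr (_ + _); rewrite addrAC.
rewrite (expand i j) (expand j i) (mxderivC j i p ys).
rewrite (addrC (mxderiv j y p *m A i p)).
rewrite opprD addrACA subrr add0r -mulmxBr; congr (_ *m _).
by rewrite /frame_curv opprD addrACA addrA.
Qed.

(** Separates the terms that differentiate the coefficients of [Y], which later cancel against the
    bracket, from the iterated coordinate derivatives. *)
Lemma covar_comp X Y y p : smooth_vfield Y -> mxsmooth y ->
  covar X (covar Y y) p =
  \sum_j vderiv X (fun q => Y q 0 j) p *: coord_covar j y p +
  \sum_i \sum_j (X p 0 i * Y p 0 j) *: coord_covar i (coord_covar j y) p.
Proof.
move=> Ys ys.
have Ns j : mxsmooth (fun q => Y q 0 j *: coord_covar j y q).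
  exact (mxsmoothZ (Ys j) (smooth_coord_covar j ys)).
rewrite /covar; under [X in _ = X + _]eq_bigr do rewrite scaler_suml.
rewrite [X in _ = X + _]exchange_big -big_split /=; apply: eq_bigr => i _.
rewrite mxderiv_sum; last exact Ns.
rewrite mulmx_suml -big_split /= scaler_sumr -big_split; apply: eq_bigr => j _ /=.
rewrite (mxderivZ _ _ (Ys j) (smooth_coord_covar j ys)) -scalemxAl -addrA -scalerDr.
by rewrite [LHS]scalerDr !scalerA.
Qed.

(** By [covar_comp] the derivatives of the coefficients of [X] and [Y] add up to the term of the
    bracket; what remains is the commutator in [coord_covarC]. *)
Lemma curvature_frame X Y Z p :
  smooth_vfield X -> smooth_vfield Y -> smooth_vfield Z ->
  curvature frame_metric X Y Z p *m theta p =
  \sum_i \sum_j (X p 0 i * Y p 0 j) *: (Z p *m theta p *m frame_curv i j p).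
Proof.
move=> Xs Ys Zs; pose z : vfield R n := fun q => Z q *m theta q.
have zs : mxsmooth z := vfield_frame_smooth Zs.
have LE U V : smooth_vfield U -> smooth_vfield V ->
    levi_civita frame_metric U (levi_civita frame_metric V Z) p *m theta p =
    covar U (covar V z) p.
  move=> Us Vs; rewrite levi_civita_frame; last exact: levi_civita_smooth.
  congr covar; apply/funext => q; exact: levi_civita_frame.
rewrite /curvature !mulmxBl (LE X Y Xs Ys) (LE Y X Ys Xs).
rewrite (levi_civita_frame _ _ Zs) -/z.
rewrite (covar_comp X p Ys zs) (covar_comp Y p Xs zs).
have -> : covar (bracket X Y) z p =
    \sum_j vderiv X (fun q => Y q 0 j) p *: coord_covar j z p -
    \sum_j vderiv Y (fun q => X q 0 j) p *: coord_covar j z p.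
  by rewrite -sumrB; apply: eq_bigr => j _; rewrite mxE scalerBl.
have cancel (a b c d : 'rV[R]_n.+1) : a + c - (b + d) - (a - b) = c - d.
  by rewrite (opprD b d) (addrACA a c) (addrC (a - b)) addrK.
rewrite cancel [X in _ - X]exchange_big -sumrB; apply: eq_bigr => i _ /=.
rewrite -sumrB; apply: eq_bigr => j _.
by rewrite (mulrC (Y p 0 j)) -scalerBr coord_covarC.
Qed.

(* The sectional curvature of the plane spanned by the [a]-th and [b]-th frame
   vectors is [k a b]. *)
Lemma scalar_curvature_frame (k : 'I_n.+1 -> 'I_n.+1 -> R) p :
  (forall i j a b, frame_curv i j p b a =
    k a b * (theta p i a * theta p j b - theta p i b * theta p j a)) ->
  scalar_curvature frame_metric p = \sum_a \sum_(b | b != a) k a b.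
Proof.
move=> Ok.
have Rm i j l :
    curvature frame_metric (coord_field i) (coord_field j) (coord_field l) p =
    row l (theta p *m frame_curv i j p *m H p).
  rewrite -[LHS]mulmx1 -(thetaK p) mulmxA.
  rewrite (curvature_frame _ (@smooth_coord_field _ _ i)
    (@smooth_coord_field _ _ j) (@smooth_coord_field _ _ l)).
  rewrite (bigD1 i) //= (bigD1 j) //= !big1 ?addr0 => [|i' i'i|j' j'j].
  - by rewrite !mxE !eqxx mulr1 scale1r !rowE !mulmxA.
  - rewrite big1 // => j' _; rewrite [coord_field i p 0 i']mxE (negPf i'i) andbF.
    by rewrite mul0r scale0r.
  - by rewrite [coord_field j p 0 j']mxE (negPf j'j) andbF mulr0 scale0r.
rewrite /scalar_curvature /ricci invmx_frame_metric.
(* Contracting with the inverse metric $H^T H$ cancels the factor $\theta$ of the curvature, as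
   $H\theta = 1$. *)
transitivity (\sum_i \sum_j ((H p)^T *m frame_curv i j p *m H p) j i).
  transitivity (\sum_j \sum_i (((H p)^T *m H p) *m
     (theta p *m frame_curv i j p *m H p)) j i); last first.
    rewrite exchange_big; apply: eq_bigr => i _; apply: eq_bigr => j _.
    congr (fun_of_matrix _ j i).
    by rewrite !mulmxA -[_ *m H p *m theta p]mulmxA dual_frame_coframe mulmx1.
  apply: eq_bigr => j _; under [RHS]eq_bigr do rewrite mxE.
  rewrite [RHS]exchange_big; apply: eq_bigr => l _ /=.
  rewrite mulr_sumr; apply: eq_bigr => i _.
  by rewrite Rm [row _ _ _ _]mxE.
have dual a b : \sum_i H p a i * theta p i b = (a == b)%:R.
  by have := congr1 (fun M : 'M_n.+1 => M a b) (dual_frame_coframe p); rewrite !mxE.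
(* By duality of [H] and [theta] the summand is $k_{ba}(1 - \delta_{ab})$, which restricts the sum
   to distinct indices. *)
transitivity (\sum_b \sum_a k b a * ((\sum_i H p b i * theta p i b) *
    (\sum_j H p a j * theta p j a) - (\sum_i H p b i * theta p i a) *
    (\sum_j H p a j * theta p j b))); last first.
  apply: eq_bigr => b _; rewrite [RHS]big_mkcond; apply: eq_bigr => a _.
  rewrite !dual !eqxx (eq_sym a b); case: (b == a) => /=; ring.
transitivity (\sum_i \sum_j \sum_b \sum_a k b a *
    ((H p b i * theta p i b) * (H p a j * theta p j a) -
     (H p b i * theta p i a) * (H p a j * theta p j b))).
  apply: eq_bigr => i _; apply: eq_bigr => j _; rewrite mxE.
  apply: eq_bigr => b _; rewrite mxE mulr_suml; apply: eq_bigr => a _.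
  by rewrite [(H p)^T _ _]mxE Ok; ring.
under eq_bigr do rewrite exchange_big.
rewrite exchange_big; apply: eq_bigr => b _ /=.
under eq_bigr do rewrite exchange_big.
rewrite exchange_big; apply: eq_bigr => a _ /=.
rewrite !big_distrlr /= -sumrB mulr_sumr; apply: eq_bigr => i _.
by rewrite -sumrB mulr_sumr.
Qed.

(** The coordinate field [i0] is the [i0]-th frame vector, and every plane containing it has
    curvature 1. In frame components the Sasakian identity is then that of curvature 1. *)
Lemma contact_curvature_frame (k : 'I_n.+1 -> 'I_n.+1 -> R) i0 X Z p :
  smooth_vfield X -> smooth_vfield Z ->
  (forall i j a b, frame_curv i j p b a =
    k a b * (theta p i a * theta p j b - theta p i b * theta p j a)) ->
  (forall a, theta p i0 a = (a == i0)%:R) ->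
  (forall a, a != i0 -> k a i0 = 1 /\ k i0 a = 1) ->
  curvature frame_metric X (coord_field i0) Z p =
  inner frame_metric (coord_field i0) Z p *: X p
  - inner frame_metric X Z p *: coord_field i0 p.
Proof.
move=> Xs Zs Ok th0 k1.
suff e : curvature frame_metric X (coord_field i0) Z p *m theta p =
    (inner frame_metric (coord_field i0) Z p *: X p
     - inner frame_metric X Z p *: coord_field i0 p) *m theta p.
  by rewrite -[LHS]mulmx1 -(thetaK p) mulmxA e -mulmxA thetaK mulmx1.
rewrite (curvature_frame _ Xs (@smooth_coord_field _ _ i0) Zs).
rewrite mulmxBl -!scalemxAl !inner_frame.
set x := X p *m theta p; set z := Z p *m theta p.
have e0E : coord_field i0 p *m theta p = delta_mx 0 i0.
  by rewrite -rowE; apply/rowP => a; rewrite !mxE th0 eqxx.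
rewrite e0E -[delta_mx 0 i0 *m _]trmxK trmx_mul trmxK trmx_delta -colE.
have -> : (col i0 z)^T 0 0 = z 0 i0 by rewrite !mxE.
apply/rowP => a; rewrite summxE.
transitivity (\sum_b z 0 b *
    (k a b * (x 0 a * (b == i0)%:R - x 0 b * (a == i0)%:R))).
  transitivity (\sum_i X p 0 i * (z *m frame_curv i i0 p) 0 a).
    apply: eq_bigr => i _; rewrite (bigD1 i0) //= big1 => [|j ji0]; last first.
      by rewrite [coord_field i0 p 0 j]mxE (negPf ji0) andbF mulr0 scale0r.
    by rewrite addr0 [coord_field i0 p 0 i0]mxE !eqxx mulr1 mxE.
  under eq_bigr do rewrite mxE mulr_sumr.
  rewrite exchange_big; apply: eq_bigr => b _ /=.
  rewrite [x 0 a]mxE [x 0 b]mxE !mulr_suml -sumrB !mulr_sumr.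
  by apply: eq_bigr => i _; rewrite Ok !th0; ring.
have rowE2 (c d : R) (u w : 'rV[R]_n.+1) :
  (c *: u - d *: w) 0 a = c * u 0 a - d * w 0 a by rewrite !mxE.
(* For a = [i0] both sides are $-\sum_{b \ne i_0} x_b z_b$; for the other a only the term b = [i0]
   contributes, giving $z_{i_0} x_a$. *)
rewrite rowE2 [delta_mx _ _ _ _]mxE eqxx /=; case: (eqVneq a i0) => [->|ai0].
  rewrite mulr1 [(x *m _) _ _]mxE (bigD1 i0) //= [in RHS](bigD1 i0) //=.
  rewrite eqxx !mulr1 subrr !mulr0 add0r [z^T _ _]mxE (mulrC (x 0 i0)) opprD addNKr.
  rewrite -sumrN; apply: eq_bigr => b bi0.
  by rewrite (negPf bi0) mulr0n (k1 b bi0).2 [z^T _ _]mxE; ring.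
rewrite mulr0n mulr0 subr0 (bigD1 i0) //= big1 => [|b bi0].
  by rewrite addr0 eqxx mulr1n ?mulr0n (k1 a ai0).1; ring.
by rewrite (negPf bi0) mulr0n; ring.
Qed.

End MovingFrame.

(** The bracket with a coordinate field differentiates components, so in the product rule only the
    derivatives of the metric coefficients are left over, and these vanish. *)
Lemma killing_coord_field {R : realType} {n : nat} (g : tensor2 R n) i0 :
  riemannian_metric g ->
  (forall i j, pderiv i0 (fun q => g q i j) = cst 0) ->
  killing g (coord_field i0).
Proof.
move=> gm g0 Y Z Ys Zs p.
have vE f : vderiv (coord_field i0) f p = pderiv i0 f p.
  rewrite /vderiv (bigD1 i0) //= big1 => [|j ji0].
    by rewrite mxE !eqxx mul1r addr0.
  by rewrite mxE (negPf ji0) andbF mul0r.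
have bE (U : vfield R n) i :
    bracket (coord_field i0) U p 0 i = pderiv i0 (fun q => U q 0 i) p.
  rewrite mxE vE /vderiv big1 ?subr0 // => j _.
  by rewrite pderiv_cst mulr0.
rewrite vE (pderiv_inner _ _ gm Ys Zs) -big_split; apply: eq_bigr => i _ /=.
rewrite -big_split; apply: eq_bigr => j _ /=.
by rewrite g0 !bE !mul0r add0r.
Qed.

(** * Surfaces of prescribed curvature *)

Section Bound.
Context {R : realType}.

Lemma nondecreasing_derive (phi dphi : R -> R) :
  (forall t, is_derive t (1 : R) phi (dphi t)) -> (forall t, 0 <= dphi t) ->
  {homo phi : x y / x <= y}.
Proof.
move=> phid dphi0 x y xy.
have [|c _ e] := @MVT_segment R phi dphi x y xy (fun t _ => phid t).
  apply: continuous_subspaceT => t; apply: differentiable_continuous.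
  by apply/derivable1_diffP; have [] := phid t.
by rewrite -subr_ge0 e mulr_ge0 // subr_ge0.
Qed.

(** For t nonnegative, $c\arctan t \mp \phi(t)$ is nondecreasing and vanishes at 0, and $\arctan <
    \pi/2 < 2$. Negative t follow by reflection. *)
Lemma bound_derive_atan (phi dphi : R -> R) (c : R) : phi 0 = 0 ->
  (forall t, is_derive t (1 : R) phi (dphi t)) ->
  (forall t, `|dphi t| <= c * (1 + t ^+ 2)^-1) ->
  forall t, `|phi t| <= c * 2.
Proof.
move=> phi0 phid dphiB t.
have c0 : 0 <= c.
  by have := le_trans (normr_ge0 _) (dphiB 0); rewrite expr0n /= addr0 invr1 mulr1.
have upper (f df : R -> R) : f 0 = 0 -> (forall t, is_derive t (1 : R) f (df t)) ->
    (forall t, df t <= c * (1 + t ^+ 2)^-1) ->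
    forall t, 0 <= t -> f t <= c * atan t.
  move=> f0 fd dfB s s0.
  have hd r : is_derive r (1 : R) (fun r => c * atan r - f r)
      (c * (1 + r ^+ 2)^-1 - df r).
    have := is_deriveB (is_deriveZ c (is_derive1_atan r)) (fd r).
    exact.
  have h0 r : 0 <= c * (1 + r ^+ 2)^-1 - df r by rewrite subr_ge0.
  have := nondecreasing_derive hd h0 s0.
  by rewrite atan0 mulr0 f0 subrr subr_ge0.
have atan2 s : atan s <= 2 :> R.
  by rewrite ltW // (lt_trans (atan_ltpi2 _) (pihalf_lt2 _)).
have pos (f df : R -> R) : f 0 = 0 -> (forall t, is_derive t (1 : R) f (df t)) ->
    (forall t, `|df t| <= c * (1 + t ^+ 2)^-1) ->
    forall t, 0 <= t -> `|f t| <= c * 2.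
  move=> f0 fd dfB s s0; rewrite (@le_trans _ _ (c * atan s)) ?ler_wpM2l //.
  rewrite ler_norml; apply/andP; split.
    rewrite lerNl; apply: (upper (fun r => - f r) (fun r => - df r)) => //.
    - by rewrite f0 oppr0.
    - by move=> r; rewrite (le_trans _ (dfB r)) // -normrN ler_norm.
  by apply: (upper f df) => // r; rewrite (le_trans _ (dfB r)) // ler_norm.
have [t0|/ltW t0] := leP 0 t; first exact: (pos phi dphi).
rewrite -[t]opprK; apply: (pos (fun r => phi (- r)) (fun r => - dphi (- r))).
- by rewrite oppr0.
- move=> r; have rd := is_deriveN (is_derive_id r (1 : R)).
  have pd : is_derive ((fun s : R => - s) r) (1 : R) phi (dphi (- r)).
    exact: phid.
  have := is_derive1_comp (g := fun s : R => - s) pd rd.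
  by rewrite /GRing.scale /= mulrN1.
- by move=> r; have := dphiB (- r); rewrite normrN sqrrN.
- by rewrite oppr_ge0.
Qed.

End Bound.

(** * A global solution of the curvature equation *)

Section Surface.
Context {R : realType} {n : nat}.
Implicit Types (f : scalar_fun R n) (p : 'rV[R]_n.+1).

(** On the line through [p] in direction [i], based at the projection [q] of [p] to $x_i = 0$, the
    primitive vanishes at 0 and has derivative [f], so [bound_derive_atan] applies. *)
Lemma primitive_bound i f (c : R) : smooth f ->
  (forall p, `|f p| <= c * (1 + p 0 i ^+ 2)^-1) ->
  forall p, `|primitive i f p| <= c * 2.
Proof.
move=> fs fB p; pose q := p - p 0 i *: delta_mx 0 i.
have qi t : (t *: delta_mx 0 i + q) 0 i = t.
  by rewrite !mxE !eqxx /= !mulr1 subrr addr0.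
have [_ Pd] := smooth_regular (smooth_primitive i fs).
have phid t : is_derive t (1 : R) (fun t => primitive i f (t *: delta_mx 0 i + q))
    (f (t *: delta_mx 0 i + q)).
  have := is_derive_line (Pd i (t *: delta_mx 0 i + q)).
  rewrite -[X in is_derive _ _ _ X]/(pderiv i (primitive i f) _).
  by rewrite pderiv_primitive.
have phiB t : `|f (t *: delta_mx 0 i + q)| <= c * (1 + t ^+ 2)^-1.
  by have := fB (t *: delta_mx 0 i + q); rewrite qi.
have phi0 : primitive i f (0 *: delta_mx 0 i + q) = 0 by rewrite primitive0 // qi.
have := bound_derive_atan (phi := fun t => primitive i f (t *: delta_mx 0 i + q))
  phi0 phid phiB (p 0 i).
by rewrite /q addrC subrK.
Qed.

Lemma smooth_sqr f : smooth f -> smooth (fun p => 1 + f p ^+ 2).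
Proof. by move=> fs; exact (smoothD (smooth_cst 1) (smoothM fs fs)). Qed.

Lemma pderivD_cst f i (c : R) : smooth f ->
  pderiv i (fun p => c + f p) = pderiv i f.
Proof.
move=> fs; rewrite (pderivD _ (smooth_regular (smooth_cst c)) (smooth_regular fs)).
by apply/funext => p; rewrite pderiv_cst add0r.
Qed.

Lemma pderivZ f i (c : R) : smooth f ->
  pderiv i (fun p => c * f p) = (fun p => c * pderiv i f p).
Proof.
move=> fs; rewrite (pderivM _ (smooth_regular (smooth_cst c)) (smooth_regular fs)).
by apply/funext => p; rewrite pderiv_cst mul0r add0r.
Qed.

(* The weight mu = 1 / ((1 + K^2) (1 + x_i^2)) bounds both integrands by multiples
   of 1 / (1 + x_i^2), so that gam = 3 + \int mu lies in [1, 5] and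
   rho^2 = 21 - 2 \int K mu gam is at least 1, because |atan| < 2. *)
Lemma jacobi_system i (K : scalar_fun R n) : smooth K ->
  exists lam gam rho : scalar_fun R n,
    [/\ smooth lam, smooth gam & smooth rho] /\
    [/\ forall p, 0 < lam p, forall p, 0 < gam p,
        pderiv i gam = (fun p => lam p * rho p) &
        pderiv i rho = (fun p => - (K p * lam p * gam p))].
Proof.
move=> Ks; have xs := smooth_coord i : smooth (fun p : 'rV[R]_n.+1 => p 0 i).
pose D : scalar_fun R n := fun p => (1 + K p ^+ 2) * (1 + p 0 i ^+ 2).
have sq1 (x : R) : 0 < 1 + x ^+ 2 by rewrite ltr_pwDl // sqr_ge0.
have D0 p : 0 < D p by rewrite mulr_gt0.
have Ds : smooth D by exact (smoothM (smooth_sqr Ks) (smooth_sqr xs)).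
pose mu : scalar_fun R n := fun p => (D p)^-1.
have mus : smooth mu by apply: (smoothV _ Ds) => p; rewrite gt_eqF.
have mu0 p : 0 < mu p by rewrite invr_gt0.
pose gam : scalar_fun R n := fun p => 3 + primitive i mu p.
have Pmus := smooth_primitive i mus.
have gams : smooth gam by exact (smoothD (smooth_cst 3) Pmus).
have muE p : mu p = (1 + K p ^+ 2)^-1 * (1 + p 0 i ^+ 2)^-1.
  by rewrite /mu /D invfM.
have Pmu2 p : `|primitive i mu p| <= 1 * 2.
  apply: primitive_bound => // q; rewrite ger0_norm ?(ltW (mu0 _)) // muE.
  rewrite ler_wpM2r ?invr_ge0 ?(ltW (sq1 _)) // invf_le1 // lerDl sqr_ge0 //.
have gamB p : 1 <= gam p <= 5.
  have := Pmu2 p; rewrite /gam ler_norml mul1r => /andP[? ?].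
  by apply/andP; split; lra.
have gam0 p : 0 < gam p by have /andP[? _] := gamB p; lra.
pose F : scalar_fun R n := fun p => K p * mu p * gam p.
have Fs : smooth F by exact (smoothM (smoothM Ks mus) gams).
have PFs := smooth_primitive i Fs.
have PF p : `|primitive i F p| <= 5 * 2.
  apply: primitive_bound => // q; rewrite /F !normrM muE normrM mulrAC.
  rewrite [`|(1 + q 0 i ^+ 2)^-1|]ger0_norm ?invr_ge0 ?(ltW (sq1 _)) // mulrA.
  rewrite [X in X * _]mulrC mulrA ler_wpM2r ?invr_ge0 ?(ltW (sq1 _)) //.
  (* $|K| \le 1 + K^2$, from $(|K| - 1)^2 \ge 0$. *)
  have kB : `|(1 + K q ^+ 2)^-1| * `|K q| <= 1.
    rewrite gtr0_norm ?invr_gt0 // mulrC ler_pdivrMr // mul1r.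
    rewrite -[K q ^+ 2]real_normK ?num_real //.
    by move: (`|K q|) => x; have := sqr_ge0 (x - 1); nra.
  have /andP[_ g5] := gamB q.
  by rewrite -[5]mul1r ler_pM // ?mulr_ge0 // gtr0_norm.
pose S : scalar_fun R n := fun p => 21 + -2 * primitive i F p.
have Ss : smooth S.
  exact (smoothD (smooth_cst 21) (smoothM (smooth_cst (-2)) PFs)).
have S0 p : 0 < S p by have := PF p; rewrite /S ler_norml => /andP[? ?]; lra.
pose rho : scalar_fun R n := fun p => Num.sqrt (S p).
have rhos : smooth rho by exact (smooth_sqrt S0 Ss).
have rho0 p : 0 < rho p by rewrite sqrtr_gt0.
have rhoVs : smooth (fun p => (rho p)^-1).
  by apply: (smoothV _ rhos) => p; rewrite gt_eqF.
(* This [lam] satisfies [lam p * rho p = mu p], the derivative of [gam]. *)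
exists (fun p => mu p * (rho p)^-1), gam, rho; split.
  by split; [exact (smoothM mus rhoVs)|exact gams|exact rhos].
split; [|exact gam0| |].
- by move=> p; rewrite mulr_gt0 ?invr_gt0.
- rewrite /gam (pderivD_cst _ _ Pmus) pderiv_primitive //.
  by apply/funext => p; rewrite divfK // gt_eqF.
(* With $S = \rho^2$: $\partial_i\rho = \partial_i S/(2\rho) = -K\mu\gamma/\rho =
   -K\lambda\gamma$. *)
rewrite /rho (pderiv_sqrt i S0 (smooth_regular Ss)) /S.
rewrite (pderivD_cst _ _ (smoothM (smooth_cst (-2)) PFs)) (pderivZ _ _ PFs).
rewrite pderiv_primitive //; apply/funext => p; rewrite -/(S p) -/(rho p) /F.
have r0 : rho p != 0 by rewrite gt_eqF.
by field.
Qed.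

End Surface.

(** * The Sasakian metric *)

Section ContactFrame.
Context {R : realType}.
Implicit Types (f : scalar_fun R 2) (p : 'rV[R]_3).

(** The entries are functions rather than values, so that after a case split on the indices each one
    computes to a named function whose derivative can be rewritten. *)
Definition mx_of_seq (s : seq (seq (scalar_fun R 2))) p : 'M[R]_3 :=
  \matrix_(i, j) nth (cst 0) (nth [::] s i) j p.

Lemma mx_of_seq_coef s (i j : 'I_3) :
  (fun p => mx_of_seq s p i j) = nth (cst 0) (nth [::] s i) j.
Proof. by apply/funext => p; rewrite mxE. Qed.

Lemma mxsmooth_mx_of_seq s :
  (forall i j : 'I_3, smooth (nth (cst 0) (nth [::] s i) j)) ->
  mxsmooth (mx_of_seq s).
Proof. by move=> ss i j; rewrite mx_of_seq_coef; exact (ss i j). Qed.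

Lemma mxderiv_mx_of_seq k s p i j :
  mxderiv k (mx_of_seq s) p i j = pderiv k (nth (cst 0) (nth [::] s i) j) p.
Proof. by rewrite mxE mx_of_seq_coef. Qed.

(** The indices are written with [lift], the form in which [big_ord_recl] produces them. *)
Lemma ord3P (P : 'I_3 -> Prop) :
  P ord0 -> P (lift ord0 ord0) -> P (lift ord0 (lift ord0 ord0)) -> forall i, P i.
Proof.
move=> P0 P1 P2; case=> -[|[|[|//]]] Hi.
- by rewrite (_ : Ordinal Hi = ord0) //; exact: val_inj.
- by rewrite (_ : Ordinal Hi = lift ord0 ord0) //; exact: val_inj.
- by rewrite (_ : Ordinal Hi = lift ord0 (lift ord0 ord0)) //; exact: val_inj.
Qed.

Local Notation dr := (@ord0 2).
Local Notation du := (lift (@ord0 2) ord0).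
Local Notation dv := (lift (@ord0 2) (lift ord0 ord0)).

Variables lam gam rho bet alp K : scalar_fun R 2.
Hypotheses (lams : smooth lam) (gams : smooth gam) (rhos : smooth rho).
Hypotheses (bets : smooth bet) (alps : smooth alp).
Hypotheses (lam0 : forall p, 0 < lam p) (gam0 : forall p, 0 < gam p).
Hypothesis lam_r : pderiv dr lam = cst 0.
Hypothesis gam_r : pderiv dr gam = cst 0.
Hypothesis rho_r : pderiv dr rho = cst 0.
Hypothesis bet_r : pderiv dr bet = cst 0.
Hypothesis alp_r : pderiv dr alp = cst 0.
(** [gam_u] and [rho_u] say that the surface has Gauss curvature [K], [bet_u] that $e^1 =
    \lambda\,du + \beta\,dv$ is closed, and [alp_u] that $d(dr + \alpha\,dv) = 2e^1 \wedge e^2$. *)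
Hypothesis gam_u : pderiv du gam = fun p => lam p * rho p.
Hypothesis rho_u : pderiv du rho = fun p => - (K p * lam p * gam p).
Hypothesis bet_u : pderiv du bet = pderiv dv lam.
Hypothesis alp_u : pderiv du alp = fun p => 2 * (lam p * gam p).

(** Pointwise operations get names so that the rules for [pderiv] can match them; they are unfolded
    only for the final algebra. *)
Let c0 : scalar_fun R 2 := cst 0.
Let c1 : scalar_fun R 2 := cst 1.
Let opp f : scalar_fun R 2 := fun p => - f p.
Let inv f : scalar_fun R 2 := fun p => (f p)^-1.
Let add f h : scalar_fun R 2 := fun p => f p + h p.
Let mul f h : scalar_fun R 2 := fun p => f p * h p.

Lemma pderivN f i : smooth f -> pderiv i (opp f) = opp (pderiv i f).
Proof.
move=> fs; rewrite (_ : opp f = fun p => -1 * f p); last first.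
  by apply/funext => p; rewrite mulN1r.
by rewrite (pderivZ _ _ fs); apply/funext => p; rewrite mulN1r.
Qed.

(* The coframe e^0 = dr + alp dv, e^1 = lam du + bet dv, e^2 = gam dv; its
   structure equations de^0 = 2 e^1 /\ e^2, de^1 = 0,
   de^2 = (rho / gam) e^1 /\ e^2 give the connection forms omega^0_1 = e^2,
   omega^0_2 = - e^1, omega^1_2 = - e^0 - rho dv. *)
Definition coframe := mx_of_seq
  [:: [:: c1; c0; c0]; [:: c0; lam; c0]; [:: alp; bet; gam]].

(** The rows are the frame vectors $e_0 = \partial_r$, $e_1 = \lambda^{-1}\partial_u$ and $e_2 =
    \gamma^{-1}(\partial_v - \alpha\,\partial_r - \beta\lambda^{-1}\partial_u)$. *)
Definition dual_frame := mx_of_seq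
  [:: [:: c1; c0; c0]; [:: c0; inv lam; c0];
      [:: opp (mul alp (inv gam)); opp (mul bet (mul (inv lam) (inv gam)));
          inv gam]].

(** The three matrices are the values on $\partial_r$, $\partial_u$ and $\partial_v$, with
    $\omega^a_b$ in row b and column a. *)
Definition connection (i : 'I_3) := mx_of_seq (nth [::]
  [:: [:: [:: c0; c0; c0]; [:: c0; c0; c1]; [:: c0; opp c1; c0]];
      [:: [:: c0; c0; lam]; [:: c0; c0; c0]; [:: opp lam; c0; c0]];
      [:: [:: c0; opp gam; bet]; [:: gam; c0; add alp rho];
          [:: opp bet; opp (add alp rho); c0]]] i).

Let c0s : smooth c0 := smooth_cst 0.
Let c1s : smooth c1 := smooth_cst 1.
Let ars : smooth (add alp rho) := smoothD alps rhos.

Lemma coframe_smooth : mxsmooth coframe.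
Proof.
apply: mxsmooth_mx_of_seq; elim/ord3P; elim/ord3P.
1: exact c1s. 1-3: exact c0s. 1: exact lams. 1: exact c0s.
1: exact alps. 1: exact bets. 1: exact gams.
Qed.

Lemma dual_frame_smooth : mxsmooth dual_frame.
Proof.
have lVs : smooth (inv lam) by apply: (smoothV _ lams) => p; rewrite gt_eqF.
have gVs : smooth (inv gam) by apply: (smoothV _ gams) => p; rewrite gt_eqF.
apply: mxsmooth_mx_of_seq; elim/ord3P; elim/ord3P.
1: exact c1s. 1-3: exact c0s. 1: exact lVs. 1: exact c0s.
1: exact (smoothN (smoothM alps gVs)).
1: exact (smoothN (smoothM bets (smoothM lVs gVs))).
1: exact gVs.
Qed.

Lemma connection_smooth i : mxsmooth (connection i).
Proof.
move: i; elim/ord3P; apply: mxsmooth_mx_of_seq; elim/ord3P; elim/ord3P.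
1-5: exact c0s. 1: exact c1s. 1: exact c0s. 1: exact (smoothN c1s). 1: exact c0s.
1-2: exact c0s. 1: exact lams. 1-3: exact c0s.
1: exact (smoothN lams). 1-2: exact c0s.
1: exact c0s. 1: exact (smoothN gams). 1: exact bets.
1: exact gams. 1: exact c0s. 1: exact ars.
1: exact (smoothN bets). 1: exact (smoothN ars). 1: exact c0s.
Qed.

Lemma coframeK p : coframe p *m dual_frame p = 1%:M.
Proof.
have [l0 g0] : lam p != 0 /\ gam p != 0 by rewrite !gt_eqF.
apply/matrixP; elim/ord3P; elim/ord3P;
  rewrite !mxE !big_ord_recl big_ord0 !mxE /= /opp /mul /inv /c0 /c1 /cst;
  by field; rewrite ?l0 ?g0.
Qed.

Lemma connection_skew i p : (connection i p)^T = - connection i p.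
Proof.
apply/matrixP => a b; rewrite !mxE; move: i a b.
by elim/ord3P; elim/ord3P; elim/ord3P; rewrite /= /opp /c0 /cst ?oppr0 ?opprK.
Qed.

(** Cartan's first structure equation, checked entry by entry from the independence of r and the
    equations for [gam], [bet] and [alp]. *)
Lemma connection_torsion_free i j p k :
  (mxderiv i coframe p + coframe p *m connection i p) j k =
  (mxderiv j coframe p + coframe p *m connection j p) i k.
Proof.
rewrite !mxE !mx_of_seq_coef !big_ord_recl !big_ord0 !mxE.
move: i j k; elim/ord3P; elim/ord3P; elim/ord3P;
  rewrite /= ?pderiv_cst ?lam_r ?gam_r ?bet_r ?alp_r ?gam_u ?bet_u ?alp_u;
  rewrite /opp /add /c0 /c1 /cst; by ring.
Qed.

Definition sectional (a b : 'I_3) p : R :=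
  if (a == ord0) || (b == ord0) then 1 else K p - 3.

(** Cartan's second structure equation, checked on all 81 entries; [K] enters through [rho_u]. *)
Lemma connection_curvature i j p a b : frame_curv connection i j p b a =
  sectional a b p *
  (coframe p i a * coframe p j b - coframe p i b * coframe p j a).
Proof.
rewrite /frame_curv /connection !mxE !mx_of_seq_coef !big_ord_recl !big_ord0 !mxE.
have arE k : pderiv k (add alp rho) = add (pderiv k alp) (pderiv k rho).
  exact (pderivD k (smooth_regular alps) (smooth_regular rhos)).
move: i j a b; elim/ord3P; elim/ord3P; elim/ord3P; elim/ord3P;
  rewrite /sectional /= ?(pderivN _ lams) ?(pderivN _ gams) ?(pderivN _ bets)
    ?(pderivN _ ars) ?(pderivN _ c1s) ?arE
    ?pderiv_cst ?lam_r ?gam_r ?bet_r ?alp_r ?rho_r ?gam_u ?bet_u ?alp_u ?rho_u;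
  rewrite /opp /add /c0 /c1 /cst; by ring.
Qed.

Lemma coframe_r p a : coframe p dr a = (a == dr)%:R.
Proof. by rewrite mxE; move: a; elim/ord3P. Qed.

Lemma contact_metric_sasakian :
  sasakian_structure (frame_metric coframe) (coord_field dr).
Proof.
have gm := frame_metric_riemannian coframe_smooth coframeK.
split; first exact gm.
- exact: smooth_coord_field.
- move=> p; rewrite inner_frame.
  have -> : coord_field dr p *m coframe p = delta_mx 0 dr.
    by rewrite -rowE; apply/rowP => a; rewrite mxE coframe_r mxE.
  by rewrite trmx_delta mul_delta_mx mxE !eqxx.
(* The coefficients of the coframe do not depend on r, hence neither do those of the metric. *)
- apply: killing_coord_field gm _ => i j.
  have d0 q : mxderiv dr coframe q = 0.
    apply/matrixP => a b; rewrite mxderiv_mx_of_seq [RHS]mxE; move: a b.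
    by elim/ord3P; elim/ord3P;
      rewrite /= ?pderiv_cst ?lam_r ?gam_r ?bet_r ?alp_r.
  apply/funext => p; transitivity (mxderiv dr (frame_metric coframe) p i j).
    by rewrite [RHS]mxE.
  rewrite (mxderivM _ _ coframe_smooth (mxsmooth_tr coframe_smooth)).
  by rewrite mxderiv_tr d0 mul0mx trmx0 mulmx0 addr0 mxE.
- move=> X Z Xs Zs p.
  apply: (contact_curvature_frame coframe_smooth dual_frame_smooth connection_smooth
    coframeK connection_skew connection_torsion_free
    (k := fun a b => sectional a b p) Xs Zs).
  + by move=> i j a b; exact: connection_curvature.
  + exact: coframe_r.
  + by move=> a /negPf a0; rewrite /sectional a0 eqxx.
Qed.

(** Of the six ordered pairs of frame vectors, four contain $e_0$ and contribute 1 each, and two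
    contribute $K - 3$ each. *)
Lemma contact_metric_scalar_curvature p :
  scalar_curvature (frame_metric coframe) p = 2 * K p - 2.
Proof.
rewrite (scalar_curvature_frame coframe_smooth dual_frame_smooth connection_smooth
  coframeK connection_skew connection_torsion_free
  (k := fun a b => sectional a b p)).
  under eq_bigr do rewrite big_mkcond /= !big_ord_recl big_ord0.
  by rewrite !big_ord_recl big_ord0 /sectional /=; ring.
by move=> i j a b; exact: connection_curvature.
Qed.

Lemma contact_metric :
  sasakian_structure (frame_metric coframe) (coord_field dr) /\
  forall p, scalar_curvature (frame_metric coframe) p = 2 * K p - 2.
Proof.
by split; [exact contact_metric_sasakian|exact contact_metric_scalar_curvature].
Qed.

End ContactFrame.

(** * Assembly of the structure from the surface data *)

Theorem corollary5 (R : realType) (f : 'rV[R]_2 -> R) (hf : smooth f) :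
  exists (g : 'rV[R]_3 -> 'M[R]_3) (e0 : 'rV[R]_3 -> 'rV[R]_3),
    sasakian_structure g e0 /\
    forall r u v : R,
      scalar_curvature g (\row_(i < 3) [:: r; u; v]`_i)
      = f (\row_(i < 2) [:: u; v]`_i).
Proof.
(* Chosen so that $2K - 2 = f$. *)
pose K : scalar_fun R 1 := fun q => 1 + 2^-1 * f q.
have Ks : smooth K by exact (smoothD (smooth_cst 1) (smoothM (smooth_cst 2^-1) hf)).
have [lam [gam [rho [[lams gams rhos] [lam0 gam0 gam_u rho_u]]]]] :=
  jacobi_system ord0 Ks.
pose w : scalar_fun R 1 := fun q => 2 * (lam q * gam q).
have ws : smooth w by exact (smoothM (smooth_cst 2) (smoothM lams gams)).
(* On the plane [ord0] is the index of u and [lift ord0 ord0] that of v. The coefficients [bet] and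
   [alp] are the primitives in u of $\lambda_v$ and $2\lambda\gamma$. *)
have lam_vs := smooth_pderiv (lift ord0 ord0) lams.
have bets := smooth_primitive ord0 lam_vs; have alps := smooth_primitive ord0 ws.
have bet_u := pderiv_primitive ord0 lam_vs; have alp_u := pderiv_primitive ord0 ws.
(* Pulling back along [base] makes all data independent of r and shifts the indices of u and v by
   one. *)
pose up (h : scalar_fun R 1) : scalar_fun R 2 := fun p => h (base p).
have up_u h i : smooth h -> pderiv (lift ord0 i) (up h) = up (pderiv i h).
  by move=> hs; exact (pderiv_baseS i (smooth_regular hs)).
have up_r h : pderiv ord0 (up h) = cst 0 := pderiv_base0 h.
have [|||||||||||||||| sas scal] := @contact_metric R (up lam) (up gam) (up rho)
  (up (primitive ord0 (pderiv (lift ord0 ord0) lam)))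
  (up (primitive ord0 w)) (up K).
- exact (smooth_base lams).
- exact (smooth_base gams).
- exact (smooth_base rhos).
- exact (smooth_base bets).
- exact (smooth_base alps).
- by move=> p; exact: lam0.
- by move=> p; exact: gam0.
- exact: up_r.
- exact: up_r.
- exact: up_r.
- exact: up_r.
- exact: up_r.
- by rewrite (up_u _ _ gams) gam_u.
- by rewrite (up_u _ _ rhos) rho_u.
- by rewrite (up_u _ _ bets) bet_u (up_u _ _ lams).
- by rewrite (up_u _ _ alps) alp_u.
eexists _, _; split; first exact sas.
move=> r u v; rewrite scal /up /K.
rewrite (_ : base _ = \row_(i < 2) [:: u; v]`_i); first by field.
by apply/rowP => i; rewrite !mxE.
Qed.
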